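(* Let $A$ be a finite dimensional algebra over a perfect field $k$, let $\Gamma$ be an Auslander-Reiten component of $A$, and let $F\colon \mathcal C\to \mathrm{ind}\,\Gamma$ be a functor with the covering property, where $\mathcal C$ is a $k$-linear category with length. Let $f\colon X\to Y$ be a morphism in $\mathrm{mod}\,A$ such that every indecomposable direct summand of $X\oplus Y$ lies in $\Gamma$. Let $d\geqslant 1$ be an integer. Assume that - $f$ lies in $\mathrm{rad}^d\backslash \mathrm{rad}^{d+1}$ and is homogeneous up to $\mathrm{rad}^{d+1}$ (with respect to $F$), - $f$ has finite left degree, denoted by $n=d_\ell(f)$. Then: 1. there exists $f'\colon X\to Y$ such that $f-f'\in \mathrm{rad}^{d+1}$ and such that the inclusion morphism $i\colon \mathrm{Ker}(f')\to X$ lies in $\mathrm{rad}^n\backslash\mathrm{rad}^{n+1}$; 2. there exists a direct sum decomposition $\mathrm{Ker}(f') = \left(\bigoplus_{m\geqslant n}K^{(m)}\right)\oplus K^{(\infty)}$ such that the restriction of $i$ to any indecomposable direct summand of $K^{(m)}$ (respectively, of $K^{(\infty)}$) lies in $\mathrm{rad}^m\backslash\mathrm{rad}^{m+1}$ (respectively, in $\mathrm{rad}^\infty$); 3. for every integer $\ell\geqslant n$ and every indecomposable $Z\in \mathrm{mod}\,A$, the following sequence is exact $$0\to \bigoplus_{n\leqslant m \leqslant \ell} \frac{\mathrm{rad}^{\ell-m}}{\mathrm{rad}^{\ell-m+1}}(Z,K^{(m)}) \xrightarrow{-\cdot i} \frac{\mathrm{rad}^{\ell}}{\mathrm{rad}^{\ell+1}}(Z,X)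 \xrightarrow{-\cdot f} \frac{\mathrm{rad}^{\ell+d}}{\mathrm{rad}^{\ell+d+1}}(Z,Y),$$ where the first map is induced by composing with the restrictions $K^{(m)}\to X$ of $i$ and the second by composing with $f$.
   Context: **Radical.** $\mathrm{mod}\,A$ is the category of finitely generated $A$-modules. $\mathrm{rad}$ is the ideal of $\mathrm{mod}\,A$ generated by the non-isomorphisms between indecomposable modules; $\mathrm{rad}^0=\mathrm{mod}\,A$ (all morphisms), $\mathrm{rad}^{\ell+1}=\mathrm{rad}^\ell\cdot\mathrm{rad}=\mathrm{rad}\cdot\mathrm{rad}^\ell$, $\mathrm{rad}^\infty=\bigcap_{\ell\geqslant 0}\mathrm{rad}^\ell$. Compositions are written from left to right: for $g\colon Z\to X$ and $f\colon X\to Y$ the composite is $gf\colon Z\to Y$. $\mathrm{rad}^\ell/\mathrm{rad}^{\ell+1}(Z,X)$ means $\mathrm{rad}^\ell(Z,X)/\mathrm{rad}^{\ell+1}(Z,X)$. **Left degree.** For $f\colon X\to Y$ in $\mathrm{rad}^d\backslash\mathrm{rad}^{d+1}$ with $d\geqslant 1$, $d_\ell(f)$ is the least integer $m\geqslant 0$ such that there exist an indecomposable $Z\in\mathrm{mod}\,A$ and $g\colon Z\to X$ in $\mathrm{rad}^m\backslash\mathrm{rad}^{m+1}$ with $gf\in\mathrm{rad}^{m+d+1}$; $d_\ell(f)=\infty$ if there is none. **Auslander-Reiten components.** $\mathrm{ind}\,A$ is a full subcategory of $\mathrm{mod}\,A$ containing exactly one representative of each isomorphism class of indecomposable modules. The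 Auslander-Reiten quiver has the objects of $\mathrm{ind}\,A$ as vertices, with exactly one arrow $X\to Y$ when $\mathrm{rad}(X,Y)/\mathrm{rad}^2(X,Y)\neq 0$. An Auslander-Reiten component $\Gamma$ is a connected component of it; $\mathrm{ind}\,\Gamma$ is the full subcategory of $\mathrm{ind}\,A$ with objects the modules in $\Gamma$. **Categories with length.** Let $\mathcal C$ be a $k$-linear category with finite dimensional morphism spaces in which distinct objects are not isomorphic. $\mathcal{RC}$ is the ideal of $\mathcal C$ consisting of the non-invertible morphisms; $\mathcal R^0\mathcal C=\mathcal C$, $\mathcal R^{\ell+1}\mathcal C=\mathcal R^\ell\mathcal C\cdot\mathcal{RC}=\mathcal{RC}\cdot\mathcal R^\ell\mathcal C$. A morphism of $\mathcal C$ is irreducible if it lies in $\mathcal{RC}$ and not in $\mathcal R^2\mathcal C$. A path of length $n\geqslant 0$ is a sequence $x_0\to x_1\to\cdots\to x_n$ of $n$ irreducible morphisms. $\mathcal C$ is a category with length if (a) for all $x,y\in\mathcal C$, all paths of irreducible morphisms from $x$ to $y$ have the same length, and (b) $\bigcap_{n\geqslant 0}\mathcal R^n\mathcal C=0$. **Covering property.** Let $\mathcal C$ be a $k$-linear category with length. A $k$-linear functor $F\colon\mathcal C\to\mathrm{ind}\,\Gamma$ has the covering property if: (a) for every $X\in\Gamma$ there exists $x\in\mathcal C$ with $Fx=X$; (b) $F(\mathcal{RC})\subseteq\mathrm{rad}$; (c) for all $x,y\in\mathcal C$ and $n\geqslant 0$ the maps induced by $F$ $\bigoplus_{Fz=Fy}\mathcal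 R^n\mathcal C(x,z)/\mathcal R^{n+1}\mathcal C(x,z)\to \mathrm{rad}^n(Fx,Fy)/\mathrm{rad}^{n+1}(Fx,Fy)$ and $\bigoplus_{Fz=Fy}\mathcal R^n\mathcal C(z,x)/\mathcal R^{n+1}\mathcal C(z,x)\to \mathrm{rad}^n(Fy,Fx)/\mathrm{rad}^{n+1}(Fy,Fx)$ are bijective; (d) for all $x,y\in\mathcal C$ the maps induced by $F$, $\bigoplus_{Fz=Fy}\mathcal C(x,z)\to\mathrm{Hom}_A(Fx,Fy)$ and $\bigoplus_{Fz=Fy}\mathcal C(z,x)\to\mathrm{Hom}_A(Fy,Fx)$, are injective; (e) for every $x\in\mathcal C$ and $Y\in\Gamma$ there is at most one $y\in\mathcal C$ such that $Fy=Y$ and $\mathcal C(x,y)$ contains an irreducible morphism; (f) for every $X\in\Gamma$ and $y\in\mathcal C$ there is at most one $x\in\mathcal C$ such that $Fx=X$ and $\mathcal C(x,y)$ contains an irreducible morphism. **Homogeneous morphisms (with respect to $F$).** A morphism $X\to Y$ in $\mathrm{mod}\,A$ is homogeneous if there exist tuples $(x_s)_s$, $(y_t)_t$ of objects of $\mathcal C$ and morphisms $\varphi_{s,t}\in\mathcal C(x_s,y_t)$ such that $X=\bigoplus_sFx_s$, $Y=\bigoplus_tFy_t$ and, for all $s,t$, the component $Fx_s\to Fy_t$ of the morphism equals $F(\varphi_{s,t})$. A morphism $X\to Y$ is homogeneous up to $\mathrm{rad}^{d+1}$ if it is the sum of a homogeneous morphism $X\to Y$ and of a morphism lying in $\mathrm{rad}^{d+1}$.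 *)

(* Defs.v *)
From HB Require Import structures.
From mathcomp Require Import all_boot all_order all_algebra all_field.
From mathcomp Require Import boolp.
From Stdlib Require Import Relation_Operators.

Set Implicit Arguments.
Unset Strict Implicit.
Unset Printing Implicit Defensive.

Import GRing.Theory.
Local Open Scope ring_scope.

Definition perfect_field (k : fieldType) : Prop :=
  forall p : {poly k}, irreducible_poly p -> separable_poly p.

(* Over a field, this says "finite dimensional". *)
Definition fin_gen (R : nzRingType) (M : lmodType R) : Prop :=
  exists s : seq M, forall x : M,
    exists c : 'I_(size s) -> R, x = \sum_i c i *: s`_i.

(* [compm] is in diagrammatic order: [f \then g] is first [f], then [g]. *)
Record lincat (k : fieldType) := LinCat {
  obj :> Type;
  Mor : obj -> obj -> lmodType k;
  idmor : forall x, Mor x x;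
  compm : forall x y z, Mor x y -> Mor y z -> Mor x z;
  comp_idl : forall x y (f : Mor x y), compm (idmor x) f = f;
  comp_idr : forall x y (f : Mor x y), compm f (idmor y) = f;
  compmA : forall x y z t (f : Mor x y) (g : Mor y z) (h : Mor z t),
    compm f (compm g h) = compm (compm f g) h;
  comp_linl : forall x y z (c : k) (f f' : Mor x y) (g : Mor y z),
    compm (c *: f + f') g = c *: compm f g + compm f' g;
  comp_linr : forall x y z (c : k) (f : Mor x y) (g g' : Mor y z),
    compm f (c *: g + g') = c *: compm f g + compm f g' }.

Arguments Mor {k} C x y : rename.
Arguments idmor {k} C x : rename.
Arguments compm {k C x y z} f g : rename.

Notation "f \then g" := (compm f g) (at level 40, left associativity).

Definition full_subcat (k : fieldType) (C : lincat k) (P : C -> Prop) :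
  lincat k :=
  @LinCat k {x : C | P x} (fun x y => Mor C (sval x) (sval y))
    (fun x => idmor C (sval x)) (fun _ _ _ f g => f \then g)
    (fun _ _ f => comp_idl f) (fun _ _ f => comp_idr f)
    (fun _ _ _ _ f g h => compmA f g h)
    (fun _ _ _ c f f' g => comp_linl c f f' g)
    (fun _ _ _ c f g g' => comp_linr c f g g').

Record linfunctor (k : fieldType) (C D : lincat k) := LinFunctor {
  fobj :> C -> D;
  fmor : forall x y, Mor C x y -> Mor D (fobj x) (fobj y);
  fmor_lin : forall x y (c : k) (f g : Mor C x y),
    fmor (c *: f + g) = c *: fmor f + fmor g;
  fmor_id : forall x, fmor (idmor C x) = idmor D (fobj x);
  fmor_comp : forall x y z (f : Mor C x y) (g : Mor C y z),
    fmor (f \then g) = fmor f \then fmor g }.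

Arguments fmor {k C D} F {x y} f : rename.

Section Category.
Variables (k : fieldType) (C : lincat k).
Implicit Types (x y z : C).

Definition invertible x y (f : Mor C x y) : Prop :=
  exists g : Mor C y x, f \then g = idmor C x /\ g \then f = idmor C y.

Definition isomorphic x y : Prop := exists f : Mor C x y, invertible f.

Definition is_zero x : Prop := idmor C x = 0.

(* x is the direct sum of the family U.  For infinite I almost all U i are
   required to be zero, which is automatic for a module of finite length. *)
Record dsum (I : eqType) x (U : I -> C) := DSum {
  dinj : forall i, Mor C (U i) x;
  dprj : forall i, Mor C x (U i);
  inj_prj : forall i, dinj i \then dprj i = idmor C (U i);
  inj_prj0 : forall i j, i != j -> dinj i \then dprj j = 0;
  prj_inj : exists s : seq I,
    [/\ uniq s, forall i, i \notin s -> is_zero (U i)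
      & \sum_(i <- s) (dprj i \then dinj i) = idmor C x] }.

Definition indecomposable x : Prop :=
  ~ is_zero x /\
  forall U : bool -> C, dsum x U -> is_zero (U true) \/ is_zero (U false).

Definition mor_pred := forall x y, Mor C x y -> Prop.

(* Stability under scalars follows from stability under composition. *)
Definition is_ideal (I : mor_pred) : Prop :=
  [/\ forall x y, I x y 0,
      forall x y (f g : Mor C x y), I x y f -> I x y g -> I x y (f + g),
      forall x y z (f : Mor C x y) (g : Mor C y z), I x y f -> I x z (f \then g)
    & forall x y z (f : Mor C x y) (g : Mor C y z), I y z g -> I x z (f \then g)].

Definition ideal_gen (S : mor_pred) : mor_pred := fun x y f =>
  forall I : mor_pred, is_ideal I ->
    (forall u v (g : Mor C u v), S u v g -> I u v g) -> I x y f.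

Definition ideal_mul (I J : mor_pred) : mor_pred :=
  ideal_gen (fun x y f => exists z (g : Mor C x z) (h : Mor C z y),
    [/\ I x z g, J z y h & f = g \then h]).

Fixpoint ideal_pow (I : mor_pred) (n : nat) : mor_pred :=
  if n is m.+1 then ideal_mul (ideal_pow I m) I else fun _ _ _ => True.

Definition noninvertible : mor_pred := fun x y f => ~ invertible f.

Definition Rpow (n : nat) x y (f : Mor C x y) : Prop :=
  ideal_pow noninvertible n f.

Definition irreducible_mor x y (f : Mor C x y) : Prop :=
  noninvertible f /\ ~ Rpow 2 f.

Inductive irr_path : nat -> C -> C -> Prop :=
| irr_path0 x : irr_path 0 x x
| irr_pathS n x y z (f : Mor C x y) :
    irreducible_mor f -> irr_path n y z -> irr_path n.+1 x z.

Record category_with_length : Prop := CategoryWithLength {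
  cwl_findim : forall x y, fin_gen (Mor C x y);
  cwl_skeletal : forall x y, isomorphic x y -> x = y;
  cwl_ideal : is_ideal noninvertible;
  cwl_path : forall x y m n, irr_path m x y -> irr_path n x y -> m = n;
  cwl_sep : forall x y (f : Mor C x y), (forall n, Rpow n f) -> f = 0 }.

Definition radn (n : nat) x y (f : Mor C x y) : Prop :=
  ideal_pow (ideal_gen (fun u v (g : Mor C u v) =>
    [/\ indecomposable u, indecomposable v & ~ invertible g])) n f.

Definition rad_inf x y (f : Mor C x y) : Prop := forall n, radn n f.

Definition in_layer (n : nat) x y (f : Mor C x y) : Prop :=
  radn n f /\ ~ radn n.+1 f.

(* For f in rad^d \ rad^(d+1): the set of integers whose minimum is the left
   degree of f. *)
Definition left_degree_witness (d : nat) x y (f : Mor C x y) (m : nat) : Prop :=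
  exists z (g : Mor C z x),
    [/\ indecomposable z, in_layer m g & radn (m + d).+1 (g \then f)].

Definition has_left_degree (d : nat) x y (f : Mor C x y) (n : nat) : Prop :=
  left_degree_witness d f n /\
  forall m, left_degree_witness d f m -> (n <= m)%N.

End Category.

Arguments dinj {k C I x U} d i : rename.
Arguments dprj {k C I x U} d i : rename.

Section Modules.
Variables (k : fieldType) (A : falgType k).

Record fgmod := FGMod {
  fgmod_sort :> lmodType A;
  fgmod_fin_gen : fin_gen fgmod_sort }.

(* A copy of {linear X -> Y}, to carry the k-vector space structure
   (c *: f) x = c%:A *: f x. *)
Definition modhom (X Y : fgmod) := {linear X -> Y}.

Section Hom.
Variables X Y : fgmod.
Implicit Types f g h : modhom X Y.

Definition modhom_fun f : X -> Y := f.

Lemma modhomP f g : (forall x, modhom_fun f x = modhom_fun g x) -> f = g.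
Proof.
rewrite /modhom_fun; case: f g => [f cf] [g cg] /= E.
have {}E : f = g by apply: funext.
case: _ / E cg => cg; congr (GRing.Linear.Pack _).
case: cf cg => [[af] [sf]] [[ag] [sg]].
by rewrite (Prop_irrelevance af ag) (Prop_irrelevance sf sg).
Qed.

HB.instance Definition _ := gen_eqMixin (modhom X Y).
HB.instance Definition _ := gen_choiceMixin (modhom X Y).

Lemma modhom_linear f (a : A) x y :
  modhom_fun f (a *: x + y) = a *: modhom_fun f x + modhom_fun f y.
Proof. exact: linearP. Qed.

Definition mkmodhom (f : X -> Y)
    (fP : forall (a : A) x y, f (a *: x + y) = a *: f x + f y) : modhom X Y :=
  HB.pack_for {linear X -> Y} f (GRing.isLinear.Build A X Y *:%R f fP).

Fact modhom_zero_subproof (a : A) (x y : X) : (0 : Y) = a *: 0 + 0.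
Proof. by rewrite scaler0 addr0. Qed.
Definition modhom_zero : modhom X Y := mkmodhom modhom_zero_subproof.

Fact modhom_add_subproof f g (a : A) x y :
  modhom_fun f (a *: x + y) + modhom_fun g (a *: x + y) =
  a *: (modhom_fun f x + modhom_fun g x) + (modhom_fun f y + modhom_fun g y).
Proof. by rewrite !modhom_linear scalerDr addrACA. Qed.
Definition modhom_add f g : modhom X Y := mkmodhom (modhom_add_subproof f g).

Fact modhom_opp_subproof f (a : A) x y :
  - modhom_fun f (a *: x + y) = a *: - modhom_fun f x + - modhom_fun f y.
Proof. by rewrite modhom_linear opprD scalerN. Qed.
Definition modhom_opp f : modhom X Y := mkmodhom (modhom_opp_subproof f).

Fact modhom_scale_subproof (c : k) f (a : A) x y :
  c%:A *: modhom_fun f (a *: x + y) =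
  a *: (c%:A *: modhom_fun f x) + c%:A *: modhom_fun f y.
Proof. by rewrite modhom_linear scalerDr !scalerA mulr_algl mulr_algr. Qed.
Definition modhom_scale (c : k) f : modhom X Y :=
  mkmodhom (modhom_scale_subproof c f).

Fact modhom_addA : associative modhom_add.
Proof. by move=> f g h; apply: modhomP => x; apply: addrA. Qed.
Fact modhom_addC : commutative modhom_add.
Proof. by move=> f g; apply: modhomP => x; apply: addrC. Qed.
Fact modhom_add0 : left_id modhom_zero modhom_add.
Proof. by move=> f; apply: modhomP => x; apply: add0r. Qed.
Fact modhom_addN : left_inverse modhom_zero modhom_opp modhom_add.
Proof. by move=> f; apply: modhomP => x; apply: addNr. Qed.

HB.instance Definition _ := GRing.isZmodule.Build (modhom X Y)
  modhom_addA modhom_addC modhom_add0 modhom_addN.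

Fact modhom_scaleA (b c : k) f :
  modhom_scale b (modhom_scale c f) = modhom_scale (b * c) f.
Proof.
by apply: modhomP => x; rewrite /modhom_fun/= scalerA mulr_algl scalerA.
Qed.
Fact modhom_scale1 : left_id 1 modhom_scale.
Proof. by move=> f; apply: modhomP => x; rewrite /modhom_fun/= !scale1r. Qed.
Fact modhom_scaleDr : right_distributive modhom_scale +%R.
Proof. by move=> c f g; apply: modhomP => x; apply: scalerDr. Qed.
Fact modhom_scaleDl f : {morph modhom_scale^~ f : b c / b + c}.
Proof.
by move=> b c; apply: modhomP => x; rewrite /modhom_fun/= !scalerDl.
Qed.

HB.instance Definition _ := GRing.Zmodule_isLmodule.Build k (modhom X Y)
  modhom_scaleA modhom_scale1 modhom_scaleDr modhom_scaleDl.

End Hom.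

Fact modhom_id_subproof (X : fgmod) (a : A) (x y : X) :
  a *: x + y = a *: x + y.
Proof. by []. Qed.
Definition modhom_id (X : fgmod) : modhom X X :=
  mkmodhom (@modhom_id_subproof X).

Fact modhom_comp_subproof (X Y Z : fgmod) (f : modhom X Y) (g : modhom Y Z)
    (a : A) x y :
  modhom_fun g (modhom_fun f (a *: x + y)) =
  a *: modhom_fun g (modhom_fun f x) + modhom_fun g (modhom_fun f y).
Proof. by rewrite !modhom_linear. Qed.
Definition modhom_comp (X Y Z : fgmod) (f : modhom X Y) (g : modhom Y Z) :
  modhom X Z := mkmodhom (modhom_comp_subproof f g).

Fact modhom_comp_idl (X Y : fgmod) (f : modhom X Y) :
  modhom_comp (modhom_id X) f = f.
Proof. exact: modhomP. Qed.
Fact modhom_comp_idr (X Y : fgmod) (f : modhom X Y) :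
  modhom_comp f (modhom_id Y) = f.
Proof. exact: modhomP. Qed.
Fact modhom_compA (X Y Z T : fgmod)
    (f : modhom X Y) (g : modhom Y Z) (h : modhom Z T) :
  modhom_comp f (modhom_comp g h) = modhom_comp (modhom_comp f g) h.
Proof. exact: modhomP. Qed.
Fact modhom_comp_linl (X Y Z : fgmod) (c : k)
    (f f' : modhom X Y) (g : modhom Y Z) :
  modhom_comp (c *: f + f') g = c *: modhom_comp f g + modhom_comp f' g.
Proof. by apply: modhomP => x; apply: modhom_linear. Qed.
Fact modhom_comp_linr (X Y Z : fgmod) (c : k)
    (f : modhom X Y) (g g' : modhom Y Z) :
  modhom_comp f (c *: g + g') = c *: modhom_comp f g + modhom_comp f g'.
Proof. exact: modhomP. Qed.

Definition modcat : lincat k :=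
  @LinCat k fgmod (fun X Y => modhom X Y : lmodType k) modhom_id modhom_comp
    modhom_comp_idl modhom_comp_idr modhom_compA
    modhom_comp_linl modhom_comp_linr.

Definition is_kernel (K X Y : fgmod) (i : modhom K X) (f : modhom X Y) : Prop :=
  injective (modhom_fun i) /\
  forall x, modhom_fun f x = 0 <-> exists y, x = modhom_fun i y.

Definition is_indA (ind : modcat -> Prop) : Prop :=
  (forall X, ind X -> indecomposable X) /\
  forall X, indecomposable X -> exists! Y, ind Y /\ isomorphic X Y.

Definition AR_arrow (ind : modcat -> Prop) (X Y : modcat) : Prop :=
  [/\ ind X, ind Y & exists f : Mor modcat X Y, in_layer 1 f].

Definition is_AR_component (ind Gamma : modcat -> Prop) : Prop :=
  exists2 X, ind X &
    forall Y, Gamma Y <-> clos_refl_sym_trans _ (AR_arrow ind) X Y.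

(* Gamma only contains the chosen representatives. *)
Definition lies_in (Gamma : modcat -> Prop) (X : modcat) : Prop :=
  exists2 G, Gamma G & isomorphic X G.

End Modules.

Section Covering.
Variables (k : fieldType) (A : falgType k) (Gamma : modcat A -> Prop).
Let indG := full_subcat Gamma.
Variables (C : lincat k) (F : linfunctor C indG).
Implicit Types (x y z : C).

(* An element of the direct sum of the C(x, z) over all z with F z = F y, as a
   family of morphisms indexed by finitely many pairwise distinct such z;
   [out_sum] is its image in Hom_A(F x, F y).  Dually for [in_family]. *)
Record out_family x y := OutFamily {
  out_card : nat;
  out_obj : 'I_out_card -> C;
  out_inj : injective out_obj;
  out_fib : forall i, F (out_obj i) = F y;
  out_mor : forall i, Mor C x (out_obj i) }.

Arguments out_obj {x y} u i : rename.
Arguments out_fib {x y} u i : rename.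
Arguments out_mor {x y} u i : rename.

Definition out_sum x y (u : out_family x y) :
  Mor (modcat A) (sval (F x)) (sval (F y)) :=
  \sum_i ecast G (Mor (modcat A) (sval (F x)) (sval G)) (out_fib u i)
           (fmor F (out_mor u i)).

Record in_family x y := InFamily {
  in_card : nat;
  in_obj : 'I_in_card -> C;
  in_inj : injective in_obj;
  in_fib : forall i, F (in_obj i) = F y;
  in_mor : forall i, Mor C (in_obj i) x }.

Arguments in_obj {x y} u i : rename.
Arguments in_fib {x y} u i : rename.
Arguments in_mor {x y} u i : rename.

Definition in_sum x y (u : in_family x y) :
  Mor (modcat A) (sval (F y)) (sval (F x)) :=
  \sum_i ecast G (Mor (modcat A) (sval G) (sval (F x))) (in_fib u i)
           (fmor F (in_mor u i)).

(* Bijectivity of maps between quotients is stated on representatives; that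
   they are well defined follows from [cov_rad]. *)
Record covering_property : Prop := CoveringProperty {
  cov_surj : forall X : indG, exists x, F x = X;
  cov_rad : forall x y (f : Mor C x y), noninvertible f ->
    @radn k (modcat A) 1 (sval (F x)) (sval (F y)) (fmor F f);
  cov_out_inj : forall x y n (u : out_family x y),
    (forall i, Rpow n (out_mor u i)) -> radn n.+1 (out_sum u) ->
    forall i, Rpow n.+1 (out_mor u i);
  cov_out_surj : forall x y n (g : Mor (modcat A) (sval (F x)) (sval (F y))),
    radn n g -> exists2 u : out_family x y,
      forall i, Rpow n (out_mor u i) & radn n.+1 (g - out_sum u);
  cov_in_inj : forall x y n (u : in_family x y),
    (forall i, Rpow n (in_mor u i)) -> radn n.+1 (in_sum u) ->
    forall i, Rpow n.+1 (in_mor u i);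
  cov_in_surj : forall x y n (g : Mor (modcat A) (sval (F y)) (sval (F x))),
    radn n g -> exists2 u : in_family x y,
      forall i, Rpow n (in_mor u i) & radn n.+1 (g - in_sum u);
  cov_out_faithful : forall x y (u : out_family x y),
    out_sum u = 0 -> forall i, out_mor u i = 0;
  cov_in_faithful : forall x y (u : in_family x y),
    in_sum u = 0 -> forall i, in_mor u i = 0;
  cov_irr_out : forall x (Y : indG) y y', F y = Y -> F y' = Y ->
    (exists f : Mor C x y, irreducible_mor f) ->
    (exists f : Mor C x y', irreducible_mor f) -> y = y';
  cov_irr_in : forall (X : indG) y x x', F x = X -> F x' = X ->
    (exists f : Mor C x y, irreducible_mor f) ->
    (exists f : Mor C x' y, irreducible_mor f) -> x = x' }.

Definition homogeneous (X Y : modcat A) (f : Mor (modcat A) X Y) : Prop :=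
  exists (p q : nat) (x : 'I_p -> C) (y : 'I_q -> C)
         (DX : dsum X (fun s => sval (F (x s))))
         (DY : dsum Y (fun t => sval (F (y t))))
         (phi : forall s t, Mor C (x s) (y t)),
  forall s t, dinj DX s \then f \then dprj DY t = fmor F (phi s t).

Definition homogeneous_upto (m : nat) (X Y : modcat A)
    (f : Mor (modcat A) X Y) : Prop :=
  exists h r : Mor (modcat A) X Y, [/\ homogeneous h, radn m r & f = h + r].

End Covering.

(* Exactness, on representatives, of
     0 -> (+)_{n <= m <= l} rad^(l-m)/rad^(l-m+1) (Z, K m)
       -> rad^l/rad^(l+1) (Z, X) -> rad^(l+d)/rad^(l+d+1) (Z, Y),
   with maps induced by the j m : K m -> X and by f : X -> Y.  The first two
   clauses say that the maps are well defined, the next two that the first one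
   is injective and that its image is the kernel of the second one. *)
Record exact_layers (k : fieldType) (C : lincat k) (d n l : nat) (Z X Y : C)
    (K : nat -> C) (j : forall m, Mor C (K m) X) (f : Mor C X Y) : Prop :=
  ExactLayers {
  el_wd1 : forall m (h : Mor C Z (K m)), (n <= m <= l)%N ->
    (radn (l - m) h -> radn l (h \then j m)) /\
    (radn (l - m).+1 h -> radn l.+1 (h \then j m));
  el_wd2 : forall g : Mor C Z X,
    (radn l g -> radn (l + d) (g \then f)) /\
    (radn l.+1 g -> radn (l + d).+1 (g \then f));
  el_inj : forall h : (forall m, Mor C Z (K m)),
    (forall m, (n <= m <= l)%N -> radn (l - m) (h m)) ->
    radn l.+1 (\sum_(n <= m < l.+1) (h m \then j m)) ->
    forall m, (n <= m <= l)%N -> radn (l - m).+1 (h m);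
  el_exact : forall g : Mor C Z X, radn l g ->
    (radn (l + d).+1 (g \then f) <->
     exists2 h : (forall m, Mor C Z (K m)),
       forall m, (n <= m <= l)%N -> radn (l - m) (h m) &
       radn l.+1 (g - \sum_(n <= m < l.+1) (h m \then j m))) }.

(* Main.v *)
From HB Require Import structures.
Require Import Defs.
From mathcomp Require Import all_boot all_order all_algebra all_field.
From mathcomp Require Import boolp.
From Stdlib Require List Relation_Operators.

(* The degree-d part f' of the homogeneous part of f is the image under F of a
   matrix phi over C all of whose entries have degree d, so it gives a
   morphism of graded C-modules (+)_s C(-, x_s) -> (+)_t C(-, y_t); let M be
   the kernel of the latter.  By the covering property, a morphism g : Z -> X in
   rad^l such that gf lies in rad^(l+d+1) is congruent modulo rad^(l+1) to a
   sum of morphisms realizing elements of M of degree l, and these factor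
   through Ker f' since they are annihilated exactly.
   Take a family of homogeneous elements of M, at objects z_e, such that the
   induced morphism (+)_e F z_e -> Ker f' is a section, with as many elements
   as possible.  By maximality and induction on the degree it generates M, and
   it is a basis because Ker f' -> X is mono.  Then K^(m) is the sum of the
   F z_e for the elements of degree m, and a complement of (+)_e F z_e can be
   moved so that its restriction to X lies in rad^oo. *)
Set Implicit Arguments.
Unset Strict Implicit.
Unset Printing Implicit Defensive.
Import GRing.Theory.
Local Open Scope ring_scope.

(** * Ideals of linear categories *)

(** The point of passing to C is rigidity: between two given objects of a category with length all
    nonzero morphisms have one and the same degree, so a morphism of degree l that lies in R^(l+1)
    is zero. Congruences modulo the radical, which are all that f provides, thereby become equations
    over C, and the functor transports these to modules. Two obstacles shape the proof. Fibres of F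
    may be infinite and an expansion along a fibre holds only modulo a power of the radical. Hence
    no infinite sum is formed: expansions are truncated at a large finite subset and at a prescribed
    order, and single coefficients are recovered by injectivity in each degree. Moreover the graded
    kernel M controls Ker f' only up to arbitrarily high powers of the radical; what it does not see
    is K^(oo), and finite dimension of Hom spaces lets one sufficiently high power stand for rad^oo.
    An indecomposable Z outside the component has no fibre, but all its morphisms to X, to Y and to
    the K^(m) lie in rad^oo, so every term of the sequence vanishes. *)

Section LinearCategory.
Variables (k : fieldType) (D : lincat k).
Implicit Types x y z : D.

Lemma compDl x y z (f f' : Mor D x y) (g : Mor D y z) :
  (f + f') \then g = f \then g + f' \then g.
Proof. by rewrite -[f]scale1r comp_linl !scale1r. Qed.

Lemma compDr x y z (f : Mor D x y) (g g' : Mor D y z) :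
  f \then (g + g') = f \then g + f \then g'.
Proof. by rewrite -[g]scale1r comp_linr !scale1r. Qed.

Lemma comp0l x y z (g : Mor D y z) : (0 : Mor D x y) \then g = 0.
Proof. by apply: (addrI (0 \then g)); rewrite -compDl !addr0. Qed.

Lemma comp0r x y z (f : Mor D x y) : f \then (0 : Mor D y z) = 0.
Proof. by apply: (addrI (f \then 0)); rewrite -compDr !addr0. Qed.

Lemma compZl x y z c (f : Mor D x y) (g : Mor D y z) :
  (c *: f) \then g = c *: (f \then g).
Proof. by rewrite -[c *: f]addr0 comp_linl comp0l addr0. Qed.

Lemma compZr x y z c (f : Mor D x y) (g : Mor D y z) :
  f \then (c *: g) = c *: (f \then g).
Proof. by rewrite -[c *: g]addr0 comp_linr comp0r addr0. Qed.

Lemma compNl x y z (f : Mor D x y) (g : Mor D y z) :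
  (- f) \then g = - (f \then g).
Proof. by rewrite -scaleN1r compZl scaleN1r. Qed.

Lemma compNr x y z (f : Mor D x y) (g : Mor D y z) :
  f \then (- g) = - (f \then g).
Proof. by rewrite -scaleN1r compZr scaleN1r. Qed.

Lemma compBl x y z (f f' : Mor D x y) (g : Mor D y z) :
  (f - f') \then g = f \then g - f' \then g.
Proof. by rewrite compDl compNl. Qed.

Lemma compBr x y z (f : Mor D x y) (g g' : Mor D y z) :
  f \then (g - g') = f \then g - f \then g'.
Proof. by rewrite compDr compNr. Qed.

Lemma comp_suml x y z I (r : seq I) (P : pred I) (f : I -> Mor D x y)
    (g : Mor D y z) :
  (\sum_(i <- r | P i) f i) \then g = \sum_(i <- r | P i) (f i \then g).
Proof.
by apply: (big_morph (fun f => f \then g)) => [? ?|]; rewrite (compDl, comp0l).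
Qed.

Lemma comp_sumr x y z I (r : seq I) (P : pred I) (f : Mor D x y)
    (g : I -> Mor D y z) :
  f \then (\sum_(i <- r | P i) g i) = \sum_(i <- r | P i) (f \then g i).
Proof.
by apply: (big_morph (fun g => f \then g)) => [? ?|]; rewrite (compDr, comp0r).
Qed.

Lemma comp_zeror x y (f : Mor D x y) : is_zero y -> f = 0.
Proof. by move=> y0; rewrite -(comp_idr f) y0 comp0r. Qed.

Lemma invertible_id x : invertible (idmor D x).
Proof. by exists (idmor D x); rewrite comp_idl. Qed.

Lemma invertible_comp x y z (f : Mor D x y) (g : Mor D y z) :
  invertible f -> invertible g -> invertible (f \then g).
Proof.
move=> [f' [ff' f'f]] [g' [gg' g'g]]; exists (g' \then f'); split.
  by rewrite compmA -(compmA f) gg' comp_idr.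
by rewrite compmA -(compmA g') f'f comp_idr.
Qed.

Lemma isomorphic_refl x : isomorphic x x.
Proof. by exists (idmor D x); apply: invertible_id. Qed.

Lemma isomorphic_trans x y z : isomorphic x y -> isomorphic y z -> isomorphic x z.
Proof.
by move=> [f fi] [g gi]; exists (f \then g); apply: invertible_comp.
Qed.

Section Ideal.
Variables (I : mor_pred D) (hI : is_ideal I).

Lemma ideal0 x y : I (0 : Mor D x y). Proof. by case: hI. Qed.

Lemma idealD x y (f g : Mor D x y) : I f -> I g -> I (f + g).
Proof. by case: hI => _ h _ _; apply: h. Qed.

Lemma ideal_compl x y z (f : Mor D x y) (g : Mor D y z) :
  I f -> I (f \then g).
Proof. by case: hI => _ _ h _; apply: h. Qed.

Lemma ideal_compr x y z (f : Mor D x y) (g : Mor D y z) :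
  I g -> I (f \then g).
Proof. by case: hI => _ _ _ h; apply: h. Qed.

Lemma idealZ x y c (f : Mor D x y) : I f -> I (c *: f).
Proof. by rewrite -{2}[f]comp_idr -compZr; apply: ideal_compl. Qed.

Lemma idealN x y (f : Mor D x y) : I f -> I (- f).
Proof. by rewrite -scaleN1r; apply: idealZ. Qed.

Lemma idealB x y (f g : Mor D x y) : I f -> I g -> I (f - g).
Proof. by move=> If Ig; apply: idealD => //; apply: idealN. Qed.

Lemma ideal_sum x y J (r : seq J) (P : pred J) (f : J -> Mor D x y) :
  (forall j, P j -> I (f j)) -> I (\sum_(j <- r | P j) f j).
Proof. by move=> If; apply: big_ind => //; [apply: ideal0|apply: idealD]. Qed.

Lemma ideal_congr x y (f g : Mor D x y) : I (f - g) -> I g -> I f.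
Proof. by move=> Ifg Ig; rewrite -(subrK g f); apply: idealD. Qed.

End Ideal.

Lemma ideal_gen_ideal (S : mor_pred D) : is_ideal (ideal_gen S).
Proof.
split.
- by move=> x y I hI _; apply: ideal0.
- by move=> x y f g If Ig I hI hS; apply: idealD => //; [apply: If|apply: Ig].
- by move=> x y z f g If I hI hS; apply: ideal_compl => //; apply: If.
- by move=> x y z f g Ig I hI hS; apply: ideal_compr => //; apply: Ig.
Qed.

Lemma ideal_gen_sub (S : mor_pred D) x y (f : Mor D x y) :
  S x y f -> ideal_gen S f.
Proof. by move=> Sf I _; apply. Qed.

Lemma ideal_mul_ideal (I J : mor_pred D) : is_ideal (ideal_mul I J).
Proof. exact: ideal_gen_ideal. Qed.

Lemma ideal_mul_comp (I J : mor_pred D) x y z (f : Mor D x y) (g : Mor D y z) :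
  I x y f -> J y z g -> ideal_mul I J (f \then g).
Proof. by move=> If Jg; apply: ideal_gen_sub; exists y, f, g. Qed.

Lemma ideal_pow_ideal (I : mor_pred D) n : is_ideal (ideal_pow I n).
Proof. by case: n => [|n]; [|apply: ideal_mul_ideal]. Qed.

Lemma ideal_powS (I : mor_pred D) n x y (f : Mor D x y) :
  ideal_pow I n.+1 f -> ideal_pow I n f.
Proof.
move=> If; apply: If; first exact: ideal_pow_ideal.
move=> u v g [z [g1 [g2 [Ig1 _ ->]]]].
by apply: ideal_compl => //; apply: ideal_pow_ideal.
Qed.

Lemma ideal_pow_le (I : mor_pred D) m n x y (f : Mor D x y) :
  (m <= n)%N -> ideal_pow I n f -> ideal_pow I m f.
Proof.
elim: n => [|n IH]; first by rewrite leqn0 => /eqP->.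
by rewrite leq_eqVlt => /predU1P[->//|mn] /ideal_powS; apply: IH.
Qed.

Lemma ideal_pow1 (I : mor_pred D) : is_ideal I ->
  forall x y (f : Mor D x y), ideal_pow I 1 f <-> I x y f.
Proof.
move=> hI x y f; split=> [If|If].
  apply: If => // u v g [z [g1 [g2 [_ Ig2 ->]]]].
  exact: ideal_compr.
by rewrite -[f]comp_idl; apply: ideal_mul_comp.
Qed.

Lemma ideal_pow_comp (I : mor_pred D) m n x y z (f : Mor D x y) (g : Mor D y z) :
  ideal_pow I m f -> ideal_pow I n g -> ideal_pow I (m + n) (f \then g).
Proof.
elim: n => [|n IH] in x y z f g *.
  by move=> If _; rewrite addn0; apply: (ideal_compl (ideal_pow_ideal I m)).
rewrite addnS => If Ig; have hm := ideal_pow_ideal I m.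
have hmn := ideal_pow_ideal I (m + n).+1.
(* Membership in a generated ideal is used by exhibiting an ideal; letting a range over the whole
   m-th power makes [J] stable under composition on both sides. *)
pose J : mor_pred D := fun u v h =>
  forall a : Mor D x u, ideal_pow I m a -> ideal_pow I (m + n).+1 (a \then h).
suff: J y z g by move=> Jg; apply: Jg.
apply: Ig => [|u v h [w [h1 [h2 [Ih1 Ih2 ->]]]] a Ia]; last first.
  by rewrite compmA; apply: ideal_mul_comp => //; apply: IH.
split.
- by move=> u v a _; rewrite comp0r; apply: ideal0.
- move=> u v h h' Jh Jh' a Ia; rewrite compDr.
  by apply: (idealD hmn) => //; [apply: Jh|apply: Jh'].
- by move=> u v w h h' Jh a Ia; rewrite compmA; apply: (ideal_compl hmn) => //; apply: Jh.
- move=> u v w h h' Jh' a Ia; rewrite compmA; apply: Jh'.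
  exact: (ideal_compl hm).
Qed.

End LinearCategory.


(** * Krull-Schmidt categories and the radical *)

Section FiniteDimension.
Variables (k : fieldType) (V : lmodType k).

Definition findim : Prop := exists N, forall v : 'I_N.+1 -> V,
  exists c : 'I_N.+1 -> k, (exists i, c i != 0) /\ \sum_i c i *: v i = 0.

(** Isolating the least index with a nonzero coefficient leaves only later terms on the right. This
    one-sided form serves both for powers of an endomorphism and for decreasing chains. *)
Lemma findim_rel (v : nat -> V) : findim ->
  exists N (a : 'I_N) (c : 'I_N -> k),
    v a = \sum_(j < N | (a < j)%N) c j *: v j.
Proof.
move=> [N /(_ (fun i => v i)) [c [[i0 ci0] cv]]].
case: (@arg_minnP _ i0 (fun i => c i != 0) val ci0) => a ca amin.
exists N.+1, a, (fun j => - ((c a)^-1 * c j)).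
apply: (scalerI ca); move: cv; rewrite (bigD1 a) //= => /eqP.
rewrite addr_eq0 => /eqP->; rewrite scaler_sumr -sumrN.
rewrite (bigID (fun j : 'I_N.+1 => (a < j)%N)) /= addrC big1 ?add0r.
  rewrite (eq_bigl (fun j : 'I_N.+1 => (a < j)%N)) => [|j].
    by apply: eq_bigr => j _; rewrite scalerA mulrN mulrA mulfV // mul1r scaleNr.
  by case: ltngtP => [//|//|]; rewrite ?andbF // andbT => aj; rewrite neq_ltn aj orbT.
move=> j /andP[ja]; rewrite -leqNgt leq_eqVlt => /predU1P[/val_inj e|ja'].
  by rewrite e eqxx in ja.
have [->|/amin] := eqVneq (c j) 0; first by rewrite scale0r oppr0.
by rewrite leqNgt ja'.
Qed.

Lemma findim_card : findim -> exists N, forall (I : finType) (v : I -> V),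
  (forall c : I -> k, \sum_i c i *: v i = 0 -> forall i, c i = 0) ->
  (#|I| <= N)%N.
Proof.
move=> [N hN]; exists N => I v vfree; rewrite leqNgt; apply/negP => ltNI.
pose h (j : 'I_N.+1) : I := enum_val (widen_ord ltNI j).
have hI : injective h.
  by move=> i j /enum_val_inj /(congr1 val) /= /val_inj.
have [c [[i ci] cv]] := hN (v \o h).
pose c' x := \sum_(j | h j == x) c j.
suff /vfree/(_ (h i)) : \sum_x c' x *: v x = 0.
  rewrite /c' (big_pred1 i) => [e|j]; first by rewrite e eqxx in ci.
  by rewrite (inj_eq hI).
rewrite -{}[RHS]cv; under eq_bigr do rewrite scaler_suml.
rewrite (exchange_big_dep xpredT) //=; apply: eq_bigr => j _.
by rewrite (big_pred1 (h j)) // => x; rewrite eq_sym.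
Qed.

(** Otherwise there are vectors, the next one always chosen in a term of the chain that the previous
    one has left; a relation expressing one of them by later ones is then impossible. *)
Lemma findim_stable (P : nat -> V -> Prop) : findim ->
  (forall n, P n 0) -> (forall n v w, P n v -> P n w -> P n (v + w)) ->
  (forall n c v, P n v -> P n (c *: v)) ->
  (forall m n v, (m <= n)%N -> P n v -> P m v) ->
  exists N, forall v, P N v -> forall n, P n v.
Proof.
move=> hV P0 PD PZ Ple; apply: contrapT => /forallNP nstab.
have h N : exists vn : V * nat, [/\ P N vn.1, ~ P vn.2 vn.1 & (N <= vn.2)%N].
  have /existsNP[v /not_implyP[Pv /existsNP[n nP]]] := nstab N.
  exists (v, n); split=> //=; rewrite leqNgt; apply/negP => /ltnW nN.
  by apply: nP; apply: Ple Pv.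
have [g hg] := choice h.
pose s n := iter n (fun m => (g m).2) 0%N.
have sle i j : (i <= j)%N -> (s i <= s j)%N.
  move=> /subnK<-; elim: (j - i)%N => [|l IH] //.
  by apply: leq_trans IH _; rewrite addSn /=; have [] := hg (s (l + i)%N).
have [N [a [c e]]] := findim_rel (fun i => (g (s i)).1) hV.
have [_ nP _] := hg (s a); apply: nP; rewrite e.
apply: big_ind => [||j aj]; [exact: P0|exact: PD|apply: PZ].
by apply: (Ple _ (s j)); [apply: (sle a.+1 j)|case: (hg (s j))].
Qed.

End FiniteDimension.

Lemma dsum_id (k : fieldType) (D : lincat k) (I : finType) (x : D) (U : I -> D)
    (d : dsum x U) : \sum_i (dprj d i \then dinj d i) = idmor D x.
Proof.
have [s [us Us <-]] := prj_inj d.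
rewrite [RHS]big_uniq // [LHS](bigID (mem s)) /= [X in _ + X]big1 ?addr0 // => i si.
by rewrite (comp_zeror (dprj d i) (Us i si)) comp0l.
Qed.

Lemma comp_cancel (k : fieldType) (D : lincat k) (x u y z : D) (f : Mor D x u)
    (i : Mor D u y) (p : Mor D y u) (g : Mor D u z) :
  i \then p = idmor D u -> f \then i \then (p \then g) = f \then g.
Proof. by move=> ip; rewrite compmA -(compmA f) ip comp_idr. Qed.

Lemma comp_vanish (k : fieldType) (D : lincat k) (x u y v z : D) (f : Mor D x u)
    (i : Mor D u y) (p : Mor D y v) (g : Mor D v z) :
  i \then p = 0 -> f \then i \then (p \then g) = 0.
Proof. by move=> ip; rewrite compmA -(compmA f) ip comp0r comp0l. Qed.

Section Radical.
Variables (k : fieldType) (D : lincat k).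
Implicit Types x y z u v : D.

Lemma radn_ideal n : is_ideal (@radn k D n).
Proof. exact: ideal_pow_ideal. Qed.

Lemma radn_le m n x y (f : Mor D x y) : (m <= n)%N -> radn n f -> radn m f.
Proof. exact: ideal_pow_le. Qed.

Lemma radn_comp m n x y z (f : Mor D x y) (g : Mor D y z) :
  radn m f -> radn n g -> radn (m + n) (f \then g).
Proof. exact: ideal_pow_comp. Qed.

Lemma radn_compl n x y z (f : Mor D x y) (g : Mor D y z) :
  radn n f -> radn n (f \then g).
Proof. exact: (ideal_compl (radn_ideal n)). Qed.

Lemma radn_compr n x y z (f : Mor D x y) (g : Mor D y z) :
  radn n g -> radn n (f \then g).
Proof. exact: (ideal_compr (radn_ideal n)). Qed.

Lemma radn_sum n x y J (r : seq J) (P : pred J) (f : J -> Mor D x y) :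
  (forall j, P j -> radn n (f j)) -> radn n (\sum_(j <- r | P j) f j).
Proof. exact: (ideal_sum (radn_ideal n)). Qed.

Lemma radn0 n x y : radn n (0 : Mor D x y).
Proof. exact: (ideal0 (radn_ideal n)). Qed.

Lemma radnD n x y (f g : Mor D x y) : radn n f -> radn n g -> radn n (f + g).
Proof. exact: (idealD (radn_ideal n)). Qed.

Lemma radnB n x y (f g : Mor D x y) : radn n f -> radn n g -> radn n (f - g).
Proof. exact: (idealB (radn_ideal n)). Qed.

Lemma radnZ n x y c (f : Mor D x y) : radn n f -> radn n (c *: f).
Proof. exact: (idealZ (radn_ideal n)). Qed.

Lemma radn_congr n x y (f g : Mor D x y) : radn n (f - g) -> radn n g -> radn n f.
Proof. exact: (ideal_congr (radn_ideal n)). Qed.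

Lemma noninvertible_rad u v (g : Mor D u v) :
  indecomposable u -> indecomposable v -> ~ invertible g -> radn 1 g.
Proof.
move=> hu hv hg; apply/ideal_pow1; first exact: ideal_gen_ideal.
exact: ideal_gen_sub.
Qed.

End Radical.

Section EndoRing.
Variables (k : fieldType) (D : lincat k) (x : D).

(** An alias that carries the ring structure, with product in diagrammatic order. The object may be
    zero, so the ring may be trivial. *)
Definition endo : Type := Mor D x x.
HB.instance Definition _ := GRing.Lmodule.on endo.

Fact endo_mul1l : left_id (idmor D x) (fun f g : endo => f \then g : endo).
Proof. exact: comp_idl. Qed.
Fact endo_mul1r : right_id (idmor D x) (fun f g : endo => f \then g : endo).
Proof. exact: comp_idr. Qed.
Fact endo_mulA : associative (fun f g : endo => f \then g : endo).
Proof. by move=> f g h; apply: compmA. Qed.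
Fact endo_mulDl : left_distributive (fun f g : endo => f \then g : endo) +%R.
Proof. by move=> f g h; apply: compDl. Qed.
Fact endo_mulDr : right_distributive (fun f g : endo => f \then g : endo) +%R.
Proof. by move=> f g h; apply: compDr. Qed.
HB.instance Definition _ := GRing.Zmodule_isPzRing.Build endo
  endo_mulA endo_mul1l endo_mul1r endo_mulDl endo_mulDr.

Lemma endo_scaleAl c (f g : endo) : (c *: f) * g = c *: (f * g).
Proof. exact: compZl. Qed.

Lemma endo_scaleAr c (f g : endo) : f * (c *: g) = c *: (f * g).
Proof. exact: compZr. Qed.

End EndoRing.

Section KrullSchmidt.
Variables (k : fieldType) (D : lincat k).
Implicit Types x y z u v : D.
Hypothesis findimD : forall x y, findim (Mor D x y).
Hypothesis splitD : forall x (e : Mor D x x), e \then e = e ->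
  exists y (i : Mor D y x) (p : Mor D x y),
    i \then p = idmor D y /\ p \then i = e.

(** Both e and its complement split, which exhibits x as the direct sum of the two images; one of
    these is zero. *)
Lemma indecomposable_idem x (e : Mor D x x) :
  indecomposable x -> e \then e = e -> e = 0 \/ e = idmor D x.
Proof.
move=> [_ hx] ee.
have ee' : (idmor D x - e) \then (idmor D x - e) = idmor D x - e.
  by rewrite compBl !compBr !comp_idl comp_idr ee subrr subr0.
have [y [i [p [ip pi]]]] := splitD ee.
have [y' [i' [p' [ip' pi']]]] := splitD ee'.
have iE : i = i \then e by rewrite -pi compmA ip comp_idl.
have pE : p = e \then p by rewrite -pi -compmA ip comp_idr.
have iE' : i' = i' \then (idmor D x - e) by rewrite -pi' compmA ip' comp_idl.
have pE' : p' = (idmor D x - e) \then p' by rewrite -pi' -compmA ip' comp_idr.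
pose U (b : bool) := if b then y else y'.
pose inj b : Mor D (U b) x :=
  match b return Mor D (U b) x with true => i | false => i' end.
pose prj b : Mor D x (U b) :=
  match b return Mor D x (U b) with true => p | false => p' end.
have h1 b : inj b \then prj b = idmor D (U b) by case: b.
have h0 b c : b != c -> inj b \then prj c = 0.
  case: b c => [] [] //= _.
    by rewrite iE pE' compmA -(compmA i) compBr comp_idr ee subrr comp0r comp0l.
  by rewrite iE' pE compmA -(compmA i') compBl comp_idl ee subrr comp0r comp0l.
have hs : exists s : seq bool, [/\ uniq s, forall b, b \notin s -> is_zero (U b)
    & \sum_(b <- s) (prj b \then inj b) = idmor D x].
  exists [:: true; false]; split=> //; first by case.
  by rewrite big_cons big_seq1 /= pi pi' addrC subrK.
have [zy|zy'] := hx U (DSum h1 h0 hs).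
  by left; rewrite -pi (comp_zeror p zy) comp0l.
right; apply/eqP; rewrite eq_sym -subr_eq0 -pi'.
by rewrite (comp_zeror p' zy') comp0l.
Qed.

(* A linear relation between the powers of f gives f^a = f^(a+1) g with g
   commuting with f, so that f^a g^a is idempotent. *)
Lemma fitting x (f : endo x) : indecomposable x ->
  (exists n, f ^+ n = 0) \/ invertible (f : Mor D x x).
Proof.
move=> hx; have [N [a [c e]]] := findim_rel (fun i => f ^+ i) (findimD x x).
pose g : endo x := \sum_(j < N | (a < j)%N) c j *: f ^+ (j - a.+1).
have fg : f ^+ a = f ^+ a.+1 * g.
  rewrite [LHS]e mulr_sumr; apply: eq_bigr => j aj.
  by rewrite endo_scaleAr -exprD subnKC.
have cfg : GRing.comm f g.
  apply: commr_sum => j _; rewrite /GRing.comm endo_scaleAl endo_scaleAr.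
  by rewrite (commrX _ (commr_refl f)).
have fgn n : f ^+ a = f ^+ (a + n) * g ^+ n.
  elim: n => [|n IH]; first by rewrite addn0 mulr1.
  have -> : f ^+ (a + n.+1) = f ^+ n * f ^+ a.+1 by rewrite -exprD addnS addnC addnS.
  by rewrite (exprS g) mulrA -(mulrA (f ^+ n)) -fg -exprD addnC.
have cfga : f ^+ a * g ^+ a = g ^+ a * f ^+ a by apply/commrX/commr_sym/commrX/commr_sym.
have ee : (f ^+ a * g ^+ a) * (f ^+ a * g ^+ a) = f ^+ a * g ^+ a.
  by rewrite mulrA -(mulrA (f ^+ a)) -cfga mulrA -exprD -fgn.
have [e0|e1] := indecomposable_idem hx ee.
- by left; exists a; rewrite (fgn a) exprD -mulrA e0 mulr0.
have fg1 : f * g = 1.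
  have ga : g ^+ a * f ^+ a = 1 by rewrite -cfga.
  by rewrite -ga fg exprSr -!mulrA mulrA ga mul1r.
by right; exists g; split; [|rewrite -[LHS]/(g * f) -cfg].
Qed.

(** After multiplication by the inverse t of the sum, the two terms add up to 1. By Fitting,
    [f \then t] is invertible or nilpotent, and in the second case a geometric series inverts
    [g \then t]. *)
Lemma endo_local x (f g : Mor D x x) : indecomposable x ->
  invertible (f + g) -> invertible f \/ invertible g.
Proof.
move=> hx [t [fgt tfg]].
have cancel (h : Mor D x x) : invertible (h \then t) -> invertible h.
  move=> hti; rewrite -[h]comp_idr -tfg compmA; apply: invertible_comp => //.
  by exists t.
have [[n fn]|] := @fitting x (f \then t) hx; last by move=> /cancel; left.
right; apply: cancel.
pose y : endo x := f \then t; pose s : endo x := \sum_(i < n) y ^+ i.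
have -> : g \then t = (1 - y : endo x).
  by rewrite -[RHS]/(idmor D x - f \then t) -fgt compDl addrC addKr.
have ys : (1 - y) * s = 1.
  by rewrite -opprB mulNr -subrX1 fn sub0r opprK.
exists s; split=> //; rewrite -[LHS]/(s * (1 - y)).
suff -> : s * (1 - y) = (1 - y) * s by [].
rewrite mulrBl mulrBr mul1r mulr1; congr (_ - _).
by rewrite [LHS]mulr_suml mulr_sumr; apply: eq_bigr => i _; rewrite -exprS -exprSr.
Qed.

(** With t inverse to [a \then p], the endomorphism [p \then t \then a] of x is idempotent and
    nonzero, hence the identity. *)
Lemma split_indecomposable u x (a : Mor D u x) (p : Mor D x u) :
  ~ is_zero u -> indecomposable x -> invertible (a \then p) ->
  invertible a /\ invertible p.
Proof.
move=> hu hx [t [apt tap]].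
have aw : a \then (p \then t) = idmor D u by rewrite compmA.
have ai : invertible a.
  exists (p \then t); split=> //.
  have ee : (p \then t \then a) \then (p \then t \then a) = p \then t \then a.
    by rewrite -compmA (compmA a) aw comp_idl.
  have [pta0|//] := indecomposable_idem hx ee.
  case: hu; rewrite /is_zero.
  suff <- : a \then (p \then t \then a) \then (p \then t) = idmor D u.
    by rewrite pta0 comp0r comp0l.
  by rewrite (compmA a (p \then t)) aw comp_idl.
split=> //; have [a' [aa' a'a]] := ai.
have -> : p = a' \then (a \then p) by rewrite compmA a'a comp_idl.
by apply: invertible_comp; [exists a|exists t].
Qed.

(** The morphisms that no composition on both sides turns into an isomorphism of indecomposables
    form an ideal: sums are handled by [endo_local]. It contains the generators of the radical by
    [split_indecomposable]. *)
Lemma rad_noninvertible u v (g : Mor D u v) :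
  indecomposable u -> indecomposable v -> radn 1 g -> ~ invertible g.
Proof.
pose I : mor_pred D := fun x y f => forall u v (a : Mor D u x) (b : Mor D y v),
  indecomposable u -> indecomposable v -> ~ invertible (a \then f \then b).
move=> hu hv /(ideal_pow1 (ideal_gen_ideal _)) hg.
suff /(_ u v (idmor D u) (idmor D v) hu hv) : I u v g by rewrite comp_idl comp_idr.
apply: hg => [|x y f [hx hy fni] u' v' a b hu' hv' abi].
  split.
  - move=> x y u' v' a b [nu _] _ [t [abt _]]; apply: nu; rewrite /is_zero -abt.
    by rewrite comp0r !comp0l.
  - move=> x y f f' If If' u' v' a b hu' hv' [t [st ts]].
    have ci (h : Mor D u' v') : invertible (h \then t) -> invertible h.
      move=> hi; rewrite -[h]comp_idr -ts compmA; apply: invertible_comp => //.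
      by exists t.
    have := invertible_id u'; rewrite -st compDr !compDl.
    by move=> /(endo_local hu')[]/ci; [apply: If|apply: If'].
  - move=> x y z f f' If u' v' a b hu' hv'; rewrite compmA -compmA; exact: If.
  - move=> x y z f f' If u' v' a b hu' hv'; rewrite compmA; exact: If.
have [t [abt tab]] := abi.
have abti : invertible (a \then (f \then b \then t)).
  by rewrite !compmA abt; apply: invertible_id.
have [ai fbti] := split_indecomposable hu'.1 hx abti.
have [t' [fbt' _]] := fbti.
have fi : invertible (f \then (b \then t \then t')).
  by rewrite !compmA fbt'; apply: invertible_id.
by have [] := split_indecomposable hx.1 hy fi.
Qed.

Lemma not_rad_invertible u v (g : Mor D u v) :
  indecomposable u -> indecomposable v -> ~ radn 1 g -> invertible g.
Proof.
by move=> hu hv ng; apply: contrapT => /(noninvertible_rad hu hv).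
Qed.

(** Nonzero orthogonal idempotents are linearly independent. The bound serves as the measure when an
    object is decomposed and makes a maximal family of syzygies exist. *)
Lemma orthogonal_idempotents_bound x : exists N, forall (I : finType)
    (e : I -> Mor D x x), (forall i, e i <> 0) ->
  (forall i, e i \then e i = e i) ->
  (forall i j, i != j -> e i \then e j = 0) -> (#|I| <= N)%N.
Proof.
have [N hN] := findim_card (findimD x x); exists N => I e e0 ee e_ortho.
apply: (hN I e) => c ce i.
have := congr1 (fun f => f \then e i) ce.
rewrite comp_suml comp0l (bigD1 i) //= big1 => [|j ji]; last first.
  by rewrite compZl e_ortho // scaler0.
rewrite compZl ee addr0 => /eqP; rewrite scaler_eq0 => /orP[/eqP//|/eqP].
by move/e0.
Qed.

(** Only the resolution of the identity is recorded: inserting it reduces membership in an ideal to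
    indecomposables. In the induction, orthogonal idempotents of one summand together with the
    idempotent of the other are orthogonal in x, so the bound drops for each summand. *)
Lemma indecomposable_resolution x : exists (I : finType) (U : I -> D)
    (p : forall i, Mor D x (U i)) (j : forall i, Mor D (U i) x),
  (forall i, indecomposable (U i)) /\ \sum_i (p i \then j i) = idmor D x.
Proof.
have [N] := orthogonal_idempotents_bound x.
elim: N => [|N IH] in x * => hN.
  exists void, (fun _ => x), (fun _ => 0), (fun _ => 0); split; first by case.
  rewrite big_pred0; last by case.
  apply/esym; apply: contrapT => x0.
  have := hN unit (fun _ => idmor D x) (fun=> x0); rewrite card_unit.
  by move=> h; suff: (1 <= 0)%N by []; apply: h => [_|[] [] //]; rewrite comp_idl.
have [x0|x0] := pselect (is_zero x).
  exists void, (fun _ => x), (fun _ => 0), (fun _ => 0); split; first by case.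
  by rewrite big_pred0 ?x0 //; case.
have [hx|hx] := pselect (indecomposable x).
  exists unit, (fun _ => x), (fun _ => idmor D x), (fun _ => idmor D x).
  by split=> //; rewrite (big_pred1 tt) ?comp_idl //; case.
have [U [d Ut Uf]] : exists U : bool -> D, exists2 d : dsum x U, 
    ~ is_zero (U true) & ~ is_zero (U false).
  apply: contrapT => h; apply: hx; split=> // U d.
  by apply: contrapT => /not_orP[? ?]; apply: h; exists U, d.
have U0 b : ~ is_zero (U b) by case: b.
have hU b : forall (I : finType) (e : I -> Mor D (U b) (U b)),
    (forall i, e i <> 0) -> (forall i, e i \then e i = e i) ->
    (forall i j, i != j -> e i \then e j = 0) -> (#|I| <= N)%N.
  move=> I e e0 ee e_ortho.
  have dK (c : bool) : dinj d c \then dprj d c = idmor D (U c) by apply: inj_prj.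
  have d0 (c c' : bool) : c != c' -> dinj d c \then dprj d c' = 0 by apply: inj_prj0.
  pose e' (i : option I) := if i is Some i then dprj d b \then e i \then dinj d b
    else dprj d (~~ b) \then dinj d (~~ b).
  suff: (#|{: option I}| <= N.+1)%N by rewrite card_option ltnS.
  have bb (c : bool) : c != ~~ c by case: c.
  have bb' (c : bool) : ~~ c != c by case: c.
  apply: (hN _ e') => [[i|]|[i|]|[i|] [j|]] //=.
  - move=> ei0; apply: (e0 i).
    suff <- : dinj d b \then (dprj d b \then e i \then dinj d b) \then dprj d b = e i.
      by rewrite ei0 comp0r comp0l.
    by rewrite !compmA dK comp_idl -compmA dK comp_idr.
  - move=> ei0; apply: (U0 (~~ b)); rewrite /is_zero.
    suff <- : dinj d (~~ b) \then (dprj d (~~ b) \then dinj d (~~ b)) \then dprj d (~~ b)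
      = idmor D (U (~~ b)) by rewrite ei0 comp0r comp0l.
    by rewrite compmA dK comp_idl dK.
  - by rewrite -{2}(compmA (dprj d b)) comp_cancel // -compmA (compmA (e i)) ee compmA.
  - by rewrite comp_cancel.
  - move=> ij; rewrite -(compmA (dprj d b) (e j)) comp_cancel //.
    by rewrite -compmA (compmA (e i)) e_ortho // comp0l comp0r.
  - by move=> _; rewrite comp_vanish // d0.
  - by move=> _; rewrite -(compmA (dprj d b) (e j)) comp_vanish // d0.
have [It [Vt [pt [jt [Vt_indec ptjt]]]]] := IH _ (hU true).
have [If [Vf [pf [jf [Vf_indec pfjf]]]]] := IH _ (hU false).
pose V (i : It + If) := match i with inl i => Vt i | inr i => Vf i end.
pose p i : Mor D x (V i) := match i with
  inl i => dprj d true \then pt i | inr i => dprj d false \then pf i end.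
pose j i : Mor D (V i) x := match i with
  inl i => jt i \then dinj d true | inr i => jf i \then dinj d false end.
exists (It + If)%type, V, p, j; split; first by case.
rewrite big_sumType /= -(dsum_id d) big_bool; congr (_ + _).
  under eq_bigr do rewrite -compmA (compmA (pt _)).
  by rewrite -comp_sumr -comp_suml ptjt comp_idl.
under eq_bigr do rewrite -compmA (compmA (pf _)).
by rewrite -comp_sumr -comp_suml pfjf comp_idl.
Qed.

(** Some component of g along a resolution of x is not radical, hence invertible. This is what
    splits off a new member in [family_extend]. *)
Lemma not_rad_split u x (g : Mor D u x) : indecomposable u -> ~ radn 1 g ->
  exists q : Mor D x u, g \then q = idmor D u.
Proof.
move=> hu ng; have [I [U [p [j [hU pj]]]]] := indecomposable_resolution x.
have [i gp] : exists i, ~ radn 1 (g \then p i).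
  apply/existsNP => h; apply: ng; rewrite -[g]comp_idr -pj comp_sumr.
  by apply: radn_sum => i _; rewrite compmA; apply: radn_compl.
have [t [gpt _]] := not_rad_invertible hu (hU i) gp.
by exists (p i \then t); rewrite compmA.
Qed.

Lemma radn_stable x y : exists N, forall f : Mor D x y, radn N f -> rad_inf f.
Proof.
apply: (@findim_stable _ _ (fun n f => @radn k D n x y f)) => //.
- by move=> n; apply: radn0.
- by move=> n f g; apply: radnD.
- by move=> n c f; apply: radnZ.
- by move=> m n f; apply: radn_le.
Qed.

(* Some step of a factorization leads from outside of P into P; as it is not
   irreducible, the factorization can be refined there. *)
Lemma radn_outside (P : D -> Prop) :
  (forall u v, isomorphic u v -> P v -> P u) ->
  (forall u v (g : Mor D u v), indecomposable u -> indecomposable v ->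
     in_layer 1 g -> P v -> P u) ->
  forall n u v (f : Mor D u v), indecomposable u -> indecomposable v ->
    ~ P u -> P v -> radn n f -> radn n.+1 f.
Proof.
move=> Piso Parr n.
pose J m : mor_pred D := fun x y f => forall u v (a : Mor D u x) (b : Mor D y v),
  indecomposable u -> indecomposable v -> ~ P u -> P v ->
  radn m.+1 (a \then f \then b).
suff hJ x y (f : Mor D x y) : radn n f -> J n x y f.
  move=> u v f hu hv Pu Pv /hJ/(_ u v (idmor D u) (idmor D v) hu hv Pu Pv).
  by rewrite comp_idl comp_idr.
elim: n => [|n IH] in x y f *.
  move=> _ u v a b hu hv Pu Pv; apply: noninvertible_rad => // h.
  by apply: Pu; apply: Piso Pv; exists (a \then f \then b).
move=> rf; suff: J n.+1 x y f by [].
apply: rf => {x y f}.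
  have h := @radn_ideal _ D n.+2; split.
  - by move=> x y u v a b *; rewrite comp0r comp0l; apply: radn0.
  - move=> x y f g If Ig u v a b hu hv Pu Pv.
    by rewrite compDr compDl; apply: (idealD h); [apply: If|apply: Ig].
  - move=> x y z f g If u v a b hu hv Pu Pv.
    rewrite compmA -compmA; exact: If.
  - move=> x y z f g Ig u v a b hu hv Pu Pv.
    rewrite compmA; exact: Ig.
move=> x y f [z [g [h [hg hh ->]]]] u v a b hu hv Pu Pv.
have {}hh : radn 1 h by apply/(ideal_pow1 (ideal_gen_ideal _)).
have [I [U [p [j [hU pj]]]]] := indecomposable_resolution z.
rewrite compmA -[a \then g]comp_idr -pj comp_sumr !comp_suml.
apply: radn_sum => i _; rewrite (compmA _ (p i)) -2!compmA.
have [Pi|Pi] := pselect (P (U i)).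
  rewrite -addn1; apply: radn_comp; first exact: IH.
  by apply/radn_compr/radn_compl.
rewrite -addn2; apply: radn_comp; first exact/radn_compl/radn_compr.
apply: contrapT => n2; apply: Pi; apply: Parr Pv => //; split; last exact: n2.
exact/radn_compr/radn_compl.
Qed.

End KrullSchmidt.


(** * Categories with length *)

Section CategoryWithLength.
Variables (k : fieldType) (C : lincat k).
Hypothesis hC : category_with_length C.
Implicit Types x y z : C.

Lemma irr_path_cat m n x y z :
  irr_path m x y -> irr_path n y z -> irr_path (m + n) x z.
Proof.
by elim=> // {}m {}x {}y y' f fi _ IH /IH; apply: irr_pathS fi.
Qed.

Lemma irr_path1 x y (f : Mor C x y) : irreducible_mor f -> irr_path 1 x y.
Proof. by move=> fi; apply: irr_pathS fi (irr_path0 y). Qed.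

Lemma Rpow_ideal n : is_ideal (@Rpow k C n).
Proof. exact: ideal_pow_ideal. Qed.

Lemma Rpow0 n x y : Rpow n (0 : Mor C x y).
Proof. exact: (ideal0 (Rpow_ideal n)). Qed.

Lemma Rpow_sum n x y J (r : seq J) (P : pred J) (f : J -> Mor C x y) :
  (forall j, P j -> Rpow n (f j)) -> Rpow n (\sum_(j <- r | P j) f j).
Proof. exact: (ideal_sum (Rpow_ideal n)). Qed.

Lemma Rpow_le m n x y (f : Mor C x y) : (m <= n)%N -> Rpow n f -> Rpow m f.
Proof. exact: ideal_pow_le. Qed.

Lemma Rpow1 x y (f : Mor C x y) : Rpow 1 f <-> ~ invertible f.
Proof. exact: (ideal_pow1 (cwl_ideal hC)). Qed.

(** In a factorization through z with factors of degrees n and 1, either there is a path of length n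
    to z, so that the last factor cannot be irreducible and lies in R^2, or the first factor gains a
    degree by induction. *)
Lemma no_path_Rpow m x y (f : Mor C x y) :
  ~ irr_path m x y -> Rpow m f -> Rpow m.+1 f.
Proof.
pose J n : mor_pred C := fun x y f => forall u v (a : Mor C u x) (b : Mor C y v),
  ~ irr_path n u v -> Rpow n.+1 (a \then f \then b).
suff hJ n u v (g : Mor C u v) : Rpow n g -> J n u v g.
  move=> nP /hJ/(_ x y (idmor C x) (idmor C y) nP).
  by rewrite comp_idl comp_idr.
elim: n => [|n IH] in u v g *.
  move=> _ u' v' a b nP; apply/Rpow1 => h; apply: nP.
  have -> : v' = u' by apply/esym/(cwl_skeletal hC); exists (a \then g \then b).
  exact: irr_path0.
move=> rg; suff: J n.+1 u v g by [].
apply: rg => {u v g x y f}.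
  have h := Rpow_ideal n.+2; split.
  - by move=> x y u v a b _; rewrite comp0r comp0l; apply: Rpow0.
  - move=> x y f g If Ig u v a b nP.
    by rewrite compDr compDl; apply: (idealD h); [apply: If|apply: Ig].
  - move=> x y z f g If u v a b nP; rewrite compmA -compmA; exact: If.
  - move=> x y z f g Ig u v a b nP; rewrite compmA; exact: Ig.
move=> x y f [z [g [h [hg hh ->]]]] u v a b nP.
have {}hh : Rpow 1 h by apply/Rpow1.
rewrite compmA -compmA; have [Pz|Pz] := pselect (irr_path n u z).
  rewrite -addn2; apply: ideal_pow_comp.
    exact: (ideal_compr (Rpow_ideal n)).
  apply: contrapT => n2; apply: nP; rewrite -addn1; apply: irr_path_cat Pz _.
  apply: irr_path1; split; last exact: n2.
  by apply/Rpow1; apply: (ideal_compl (Rpow_ideal 1)).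
rewrite -addn1; apply: ideal_pow_comp; last exact: (ideal_compl (Rpow_ideal 1)).
have := IH _ _ g hg u z a (idmor C z) Pz.
by rewrite comp_idr.
Qed.

(** Path lengths being unique, no path from x to y is longer than l; so f passes from each power to
    the next, and the intersection of all powers is zero. *)
Lemma path_Rpow_eq0 l x y (f : Mor C x y) :
  irr_path l x y -> Rpow l.+1 f -> f = 0.
Proof.
move=> Pl rf; apply: (cwl_sep hC); elim=> [//|n IH].
have [nl|ln] := ltnP n l.+1; first by apply: Rpow_le rf.
apply: no_path_Rpow => // Pn.
by have := cwl_path hC Pl Pn => e; rewrite e ltnn in ln.
Qed.

Lemma path_Rpow l x y (f : Mor C x y) : irr_path l x y -> Rpow l f.
Proof.
move=> Pl; suff h n : (n <= l)%N -> Rpow n f by apply: h.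
elim: n => [//|n IH] nl; apply: no_path_Rpow; last exact/IH/ltnW.
by move=> Pn; have := cwl_path hC Pl Pn => e; rewrite e ltnn in nl.
Qed.

Lemma nonzero_path x y (f : Mor C x y) : f <> 0 -> exists l, irr_path l x y.
Proof.
move=> f0; apply: contrapT => /forallNP nP; apply: f0; apply: (cwl_sep hC).
by elim=> [//|n IH]; apply: no_path_Rpow.
Qed.

(** The degree of a nonzero morphism depends only on its ends: it is the common length of the paths
    between them. Zero has every degree. *)
Definition homdeg l x y (f : Mor C x y) := f <> 0 -> irr_path l x y.

Lemma homdegD l x y (f g : Mor C x y) :
  homdeg l f -> homdeg l g -> homdeg l (f + g).
Proof.
move=> hf hg fg; have [f0|/hf//] := pselect (f = 0).
by apply: hg => g0; apply: fg; rewrite f0 g0 addr0.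
Qed.

Lemma homdeg_sum l x y J (r : seq J) (P : pred J) (f : J -> Mor C x y) :
  (forall j, P j -> homdeg l (f j)) -> homdeg l (\sum_(j <- r | P j) f j).
Proof. by move=> hf; apply: big_ind => //; apply: homdegD. Qed.

Lemma homdeg_comp l m x y z (f : Mor C x y) (g : Mor C y z) :
  homdeg l f -> homdeg m g -> homdeg (l + m) (f \then g).
Proof.
move=> hf hg fg; apply: irr_path_cat (hf _) (hg _) => e; apply: fg.
  by rewrite e comp0l.
by rewrite e comp0r.
Qed.

Lemma homdeg_Rpow l x y (f : Mor C x y) : homdeg l f -> Rpow l f.
Proof.
move=> hf; have [->|/hf/path_Rpow//] := pselect (f = 0).
exact: Rpow0.
Qed.

Lemma homdeg_eq0 l x y (f : Mor C x y) : homdeg l f -> Rpow l.+1 f -> f = 0.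
Proof.
move=> hf rf; apply: contrapT => f0; apply: (f0).
exact: path_Rpow_eq0 (hf f0) rf.
Qed.

(** Since a morphism space is concentrated in a single degree, a graded component is all or
    nothing. *)
Definition graded_part l x y (f : Mor C x y) : Mor C x y :=
  if `[< irr_path l x y >] then f else 0.

Lemma graded_part_homdeg l x y (f : Mor C x y) : homdeg l (graded_part l f).
Proof. by rewrite /graded_part /homdeg; case: asboolP. Qed.

Lemma graded_partB l x y (f : Mor C x y) :
  Rpow l f -> Rpow l.+1 (f - graded_part l f).
Proof.
rewrite /graded_part; case: asboolP => h; last by rewrite subr0; apply: no_path_Rpow.
by rewrite subrr => _; apply: Rpow0.
Qed.

End CategoryWithLength.


(** * Finite sums over large index types *)

Lemma mem_In (T : eqType) (t : T) s : t \in s -> List.In t s.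
Proof.
by elim: s => [//|u s IH]; rewrite inE => /predU1P[->|/IH]; [left|right].
Qed.

(* The fibres of a functor to modules live in too large a universe to carry a
   canonical eqType structure, so finite subsets of them are handled as lists
   without repetitions in the sense of the standard library. *)
Section LargeIndex.
Variable T : Type.

Lemma nth_List (x : T) s n : List.nth n s x = nth x s n.
Proof. by elim: s n => [|y s IH] [|n] /=. Qed.

Lemma NoDup_nth (x : T) s i j : List.NoDup s -> (i < size s)%N -> (j < size s)%N ->
  nth x s i = nth x s j -> i = j.
Proof.
move=> /(List.NoDup_nth s x) us si sj; rewrite -!nth_List; apply: us.
  by apply/ltP; rewrite (_ : length s = size s) //; elim: s.
by apply/ltP; rewrite (_ : length s = size s) //; elim: s.
Qed.

Lemma In_nth (x t : T) s : List.In t s -> exists2 i, (i < size s)%N & t = nth x s i.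
Proof.
elim: s => [//|u s IH] /= [->|/IH[i si ti]]; first by exists 0%N.
by exists i.+1.
Qed.

Lemma nth_In (x : T) s i : (i < size s)%N -> List.In (nth x s i) s.
Proof. by elim: s i => [//|u s IH] [|i] /= si; [left|right; apply: IH]. Qed.

Lemma list_undup (r : seq T) :
  exists2 s, List.NoDup s & forall t, List.In t s <-> List.In t r.
Proof.
exists (List.nodup (fun x y => pselect (x = y)) r); first exact: List.NoDup_nodup.
by move=> t; apply: List.nodup_In.
Qed.

Lemma big_In0 (V : nmodType) (s : seq T) (f : T -> V) :
  (forall t, List.In t s -> f t = 0) -> \sum_(t <- s) f t = 0.
Proof.
elim: s => [|t s IH] hf; first by rewrite big_nil.
rewrite big_cons hf ?add0r; last by left.
by apply: IH => u us; apply: hf; right.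
Qed.

Lemma big_In1 (V : nmodType) (s : seq T) (f : T -> V) t0 :
  List.NoDup s -> List.In t0 s -> (forall t, t <> t0 -> f t = 0) ->
  \sum_(t <- s) f t = f t0.
Proof.
move=> us ts f0; elim: us ts => [//|t s' ts' _ IH].
rewrite big_cons => -[tt0|ts]; last first.
  by rewrite IH // f0 ?add0r // => tt0; rewrite tt0 in ts'.
subst t; rewrite big_In0 ?addr0 // => u us; apply: f0 => ut0.
by rewrite ut0 in us.
Qed.

Lemma big_exchange (V : nmodType) (J : Type) (s : seq T) (r : seq J) (P : pred J)
    (f : T -> J -> V) :
  \sum_(t <- s) \sum_(j <- r | P j) f t j = \sum_(j <- r | P j) \sum_(t <- s) f t j.
Proof.
elim: s => [|t s IH]; last first.
  by rewrite big_cons IH -big_split; apply: eq_bigr => j _; rewrite big_cons.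
by rewrite big_nil big1 // => j _; rewrite big_nil.
Qed.

Section Single.
Variables (V : T -> nmodType) (t0 : T) (v : V t0).

Definition single (t : T) : V t :=
  if pselect (t0 = t) is left e then ecast u (V u) e v else 0.

Lemma single_eq : single t0 = v.
Proof.
rewrite /single; case: pselect => // e.
by rewrite (Prop_irrelevance e (erefl t0)).
Qed.

Lemma single_neq t : t <> t0 -> single t = 0.
Proof. by rewrite /single; case: pselect => // e []. Qed.

End Single.

Implicit Types (P Q : seq T -> Prop).

(** The filter of large finite subsets. Its closure under finite intersections lets the expansions
    of finitely many components share one truncation. *)
Definition eventually P : Prop := exists r : seq T, forall s : seq T,
  List.NoDup s -> (forall t, List.In t r -> List.In t s) -> P s.

Lemma eventuallyT P : (forall s, P s) -> eventually P.
Proof. by move=> hP; exists [::] => s _ _; apply: hP. Qed.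

Lemma eventually_imp P Q :
  (forall s, List.NoDup s -> P s -> Q s) -> eventually P -> eventually Q.
Proof. by move=> PQ [r hr]; exists r => s us rs; apply: PQ => //; apply: hr. Qed.

Lemma eventually_all (I : finType) (P : I -> seq T -> Prop) :
  (forall i, eventually (P i)) -> eventually (fun s => forall i, P i s).
Proof.
move=> hP; have h i := cid (hP i).
exists (List.flat_map (fun i => sval (h i)) (enum I)) => s us sub i.
apply: (svalP (h i)) => // t tr; apply: sub; apply/List.in_flat_map.
by exists i; split=> //; apply: mem_In; rewrite mem_enum.
Qed.

(** The truncation may be forced to contain t, which gives access to the coefficient at t. *)
Lemma eventually_mem P t : eventually P ->
  exists s, [/\ List.NoDup s, List.In t s & P s].
Proof.
move=> [r hr]; have [s us hs] := list_undup (t :: r).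
exists s; split=> //; first by apply/hs; left.
by apply: hr => // u ur; apply/hs; right.
Qed.

Lemma eventually_ex P : eventually P -> exists2 s, List.NoDup s & P s.
Proof.
move=> [r hr]; have [s us hs] := list_undup r.
by exists s => //; apply: hr => // u ur; apply/hs.
Qed.

End LargeIndex.

(** * Homogeneous morphisms and their kernels *)

Section LinearFunctor.
Variables (k : fieldType) (C D : lincat k) (F : linfunctor C D).

Lemma fmorD x y (f g : Mor C x y) : fmor F (f + g) = fmor F f + fmor F g.
Proof. by rewrite -[f]scale1r fmor_lin !scale1r. Qed.

Lemma fmor0 x y : fmor F (0 : Mor C x y) = 0.
Proof. by apply: (addrI (fmor F 0)); rewrite -fmorD !addr0. Qed.

Lemma fmorN x y (f : Mor C x y) : fmor F (- f) = - fmor F f.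
Proof. by apply: (addrI (fmor F f)); rewrite -fmorD !subrr fmor0. Qed.

Lemma fmorB x y (f g : Mor C x y) : fmor F (f - g) = fmor F f - fmor F g.
Proof. by rewrite fmorD fmorN. Qed.

Lemma fmor_sum x y J (r : seq J) (P : pred J) (f : J -> Mor C x y) :
  fmor F (\sum_(j <- r | P j) f j) = \sum_(j <- r | P j) fmor F (f j).
Proof. by apply: (big_morph (fmor F)) => [? ?|]; rewrite (fmorD, fmor0). Qed.

(* The members of a fibre of F over Z are objects z of C with a comparison
   morphism Z -> F z; families of morphisms are indexed by the whole fibre, and
   finite sums over it are controlled by sufficiently large finite subsets. *)
Record fibre (Z : D) (T : Type) (ob : T -> C)
    (c : forall t, Mor D Z (F (ob t))) : Prop := Fibre {
  fibre_surj : forall y n (g : Mor D Z (F y)), radn n g ->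
    exists2 psi : forall t, Mor C (ob t) y, forall t, Rpow n (psi t) &
      eventually (fun s =>
        radn n.+1 (g - \sum_(t <- s) (c t \then fmor F (psi t))));
  fibre_inj : forall y n (psi : forall t, Mor C (ob t) y) s, List.NoDup s ->
    radn n (\sum_(t <- s) (c t \then fmor F (psi t))) ->
    forall t, List.In t s -> Rpow n (psi t) }.

Definition fibre_over (Z : D) : Prop :=
  exists (T : Type) (ob : T -> C) (c : forall t, Mor D Z (F (ob t))), fibre c.

(** The distinguished member, with identity comparison, allows a morphism starting at z itself to be
    compared with an expansion over the fibre. *)
Definition fibre_at (z : C) : Prop :=
  exists (T : Type) (ob : T -> C) (c : forall t, Mor D (F z) (F (ob t))),
    fibre c /\ exists t (e : z = ob t),
      c t = ecast u (Mor D (F z) (F u)) e (idmor D (F z)).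

End LinearFunctor.

Section DirectSum.
Variables (k : fieldType) (D : lincat k) (I : finType) (X : D) (U : I -> D).
Variable d : dsum X U.

Lemma dsum_eq V (a b : Mor D V X) :
  (forall i, a \then dprj d i = b \then dprj d i) -> a = b.
Proof.
move=> ab; rewrite -[a]comp_idr -[b]comp_idr -(dsum_id d) !comp_sumr.
by apply: eq_bigr => i _; rewrite !compmA ab.
Qed.

Lemma dsum_radn n V (a : Mor D V X) :
  (forall i, radn n (a \then dprj d i)) -> radn n a.
Proof.
move=> ha; rewrite -[a]comp_idr -(dsum_id d) comp_sumr.
by apply: radn_sum => i _; rewrite compmA; apply: radn_compl.
Qed.

Lemma dsum_radnr n V (a : Mor D X V) :
  (forall i, radn n (dinj d i \then a)) -> radn n a.
Proof.
move=> ha; rewrite -[a]comp_idl -(dsum_id d) comp_suml.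
by apply: radn_sum => i _; rewrite -compmA; apply: radn_compr.
Qed.

Lemma dsum_sum_prj V (a : forall i, Mor D V (U i)) j :
  (\sum_i (a i \then dinj d i)) \then dprj d j = a j.
Proof.
rewrite comp_suml (bigD1 j) //= big1 => [|i ij].
  by rewrite addr0 -compmA inj_prj comp_idr.
by rewrite -compmA inj_prj0 // comp0r.
Qed.

Lemma dsum_sum_inj V (a : forall i, Mor D (U i) V) j :
  dinj d j \then (\sum_i (dprj d i \then a i)) = a j.
Proof.
rewrite comp_sumr (bigD1 j) //= big1 => [|i ij].
  by rewrite addr0 compmA inj_prj comp_idl.
by rewrite compmA inj_prj0 ?comp0l // eq_sym.
Qed.

End DirectSum.

Lemma sum_by_degree (V : nmodType) (I : finType) (deg : I -> nat) (a : I -> V)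
    (r : seq nat) : uniq r ->
  \sum_(m <- r) \sum_(e | deg e == m) a e = \sum_(e | deg e \in r) a e.
Proof.
move=> ur; rewrite big_seq (exchange_big_dep (fun e => deg e \in r)) /=; last first.
  by move=> m e mr /eqP->.
apply: eq_bigr => e er; rewrite -big_seq_cond big_mkcond (bigD1_seq (deg e)) //= eqxx big1 ?addr0 //.
by move=> m me; rewrite eq_sym (negPf me).
Qed.

Section HomogeneousKernel.
Variables (k : fieldType) (C D : lincat k) (F : linfunctor C D).
Hypothesis hC : category_with_length C.
Hypothesis findimD : forall x y, findim (Mor D x y).
Hypothesis splitD : forall x (e : Mor D x x), e \then e = e ->
  exists y (i : Mor D y x) (p : Mor D x y),
    i \then p = idmor D y /\ p \then i = e.
Hypothesis F_indec : forall x, indecomposable (F x).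
Hypothesis F_rad : forall n x y (f : Mor C x y), Rpow n f -> radn n (fmor F f).
Hypothesis F_fibre : forall z, fibre_at F z.
(** Iterated from degree 0, the second alternative says that all morphisms from Z to objects in the
    image of F lie in rad^oo; it covers the modules outside the component. *)
Hypothesis D_fibre : forall Z, indecomposable Z ->
  fibre_over F Z \/
  forall n z (f : Mor D Z (F z)), radn n f -> radn n.+1 f.

(** This is [fibre_inj] for the one-element family at the distinguished member of the fibre over F
    x. *)
Lemma fmor_Rpow n x y (f : Mor C x y) : radn n (fmor F f) -> Rpow n f.
Proof.
have [T [ob [c [hc [t [e ct]]]]]] := F_fibre x; subst x => rf.
pose psi := single (V := fun t => Mor C (ob t) y) f.
have psit : psi t = f by apply: (single_eq (V := fun t => Mor C (ob t) y)).
rewrite -psit; apply: (fibre_inj hc (s := [:: t])); last by left.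
  by constructor=> [[]|]; constructor.
by rewrite big_seq1 ct psit comp_idl.
Qed.

Section Fibre.
Variables (Z : D) (T : Type) (ob : T -> C) (c : forall t, Mor D Z (F (ob t))).
Hypothesis hc : fibre c.

Lemma fibre_homdeg n y (g : Mor D Z (F y)) : radn n g ->
  exists2 psi : forall t, Mor C (ob t) y, forall t, homdeg n (psi t) &
      eventually (fun s =>
        radn n.+1 (g - \sum_(t <- s) (c t \then fmor F (psi t)))).
Proof.
move=> /(fibre_surj hc)[psi hpsi ev].
exists (fun t => graded_part n (psi t)) => [t|]; first exact: graded_part_homdeg.
apply: eventually_imp ev => s us h; apply: radn_congr h.
rewrite opprB addrCA addrAC subrr add0r -sumrB.
apply: radn_sum => t _; rewrite -compBr -fmorB; apply/radn_compr/F_rad.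
exact: graded_partB.
Qed.

Lemma fibre_approx n y (g : Mor D Z (F y)) :
  exists psi : forall t, Mor C (ob t) y,
    eventually (fun s => radn n (g - \sum_(t <- s) (c t \then fmor F (psi t)))).
Proof.
elim: n => [|n [psi [r hr]]].
  by exists (fun _ => 0); apply: eventuallyT.
have [r' ur' hr'] := list_undup r.
pose g' := g - \sum_(t <- r') (c t \then fmor F (psi t)).
have [|psi' _ [r2 hr2]] := fibre_surj hc (g := g') (n := n).
  by apply: hr => // t /hr'.
(* The coefficients found so far are cut down to the finite support [r'], so that enlarging s no
   longer changes their sum. *)
pose psi0 t : Mor C (ob t) y :=
  \sum_(u <- r') single (V := fun t => Mor C (ob t) y) (psi u) t.
exists (fun t => psi0 t + psi' t); exists (r ++ r2) => s us sub.
have -> : \sum_(t <- s) (c t \then fmor F (psi0 t + psi' t)) =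
  \sum_(t <- r') (c t \then fmor F (psi t)) +
  \sum_(t <- s) (c t \then fmor F (psi' t)).
  under eq_bigr do rewrite fmorD compDr fmor_sum comp_sumr.
  rewrite big_split big_exchange; congr (_ + _).
  suff h u : List.In u r' ->
      \sum_(t <- s) (c t \then fmor F (single (V := fun t => Mor C (ob t) y) (psi u) t)) =
      c u \then fmor F (psi u).
    elim: (r') h => [|u r'' IH] h; first by rewrite !big_nil.
    by rewrite !big_cons h; [rewrite IH // => v hv; apply: h; right|left].
  move=> /hr' ur; rewrite (big_In1 (t0 := u)) ?single_eq //.
    by apply: sub; apply/List.in_app_iff; left.
  by move=> t tu; rewrite single_neq // fmor0 comp0r.
rewrite opprD addrA; apply: hr2 => // t tr2; apply: sub.
by apply/List.in_app_iff; right.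
Qed.

End Fibre.

Section Kernel.
Variables (S R : finType) (x : S -> C) (y : R -> C) (X Y K : D).
Variables (DX : dsum X (fun s => F (x s))) (DY : dsum Y (fun r => F (y r))).
Variables (d : nat) (phi : forall s r, Mor C (x s) (y r)) (f0 : Mor D X Y).
Hypothesis phi_homdeg : forall s r, homdeg d (phi s r).
Hypothesis f0E : forall s r, dinj DX s \then f0 \then dprj DY r = fmor F (phi s r).
Variable i : Mor D K X.
Hypothesis i_mono : forall V (a b : Mor D V K), a \then i = b \then i -> a = b.
Hypothesis i_f0 : i \then f0 = 0.
Hypothesis i_univ : forall V (g : Mor D V X), g \then f0 = 0 ->
  exists u : Mor D V K, u \then i = g.

Definition realize z (psi : forall s, Mor C z (x s)) : Mor D (F z) X :=
  \sum_s (fmor F (psi s) \then dinj DX s).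

Lemma realize_prj z (psi : forall s, Mor C z (x s)) s :
  realize psi \then dprj DX s = fmor F (psi s).
Proof. exact: dsum_sum_prj. Qed.

Lemma realize_comp z z' (rho : Mor C z' z) (psi : forall s, Mor C z (x s)) :
  fmor F rho \then realize psi = realize (fun s => rho \then psi s).
Proof.
by rewrite comp_sumr; apply: eq_bigr => s _; rewrite fmor_comp compmA.
Qed.

Lemma comp_f0_prj V (g : Mor D V X) r :
  g \then f0 \then dprj DY r = \sum_s (g \then dprj DX s \then fmor F (phi s r)).
Proof.
rewrite -[g in LHS]comp_idr -(dsum_id DX) comp_sumr !comp_suml.
by apply: eq_bigr => s _; rewrite -f0E !compmA.
Qed.

(* Homogeneous elements of degree l at z of the kernel of the morphism of
   C-modules (+)_s C(-, x s) -> (+)_r C(-, y r) given by phi. *)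
Definition syzygy l z (psi : forall s, Mor C z (x s)) : Prop :=
  (forall s, homdeg l (psi s)) /\
  forall r, \sum_s (psi s \then phi s r) = 0.

Lemma realize_f0 l z (psi : forall s, Mor C z (x s)) :
  syzygy l psi -> realize psi \then f0 = 0.
Proof.
move=> [_ hpsi]; apply: (dsum_eq (d := DY)) => r; rewrite comp0l comp_f0_prj.
under eq_bigr do rewrite realize_prj -fmor_comp.
by rewrite -fmor_sum hpsi fmor0.
Qed.

Lemma realize_radn l z (psi : forall s, Mor C z (x s)) :
  syzygy l psi -> radn l (realize psi).
Proof.
move=> [hpsi _]; apply: (dsum_radn (d := DX)) => s; rewrite realize_prj.
by apply: F_rad; apply: homdeg_Rpow.
Qed.

Lemma realize_eq0 l z (psi : forall s, Mor C z (x s)) :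
  syzygy l psi -> radn l.+1 (realize psi) -> realize psi = 0.
Proof.
move=> [hpsi _] rpsi; rewrite /realize big1 // => s _.
rewrite (homdeg_eq0 hC (hpsi s)) ?fmor0 ?comp0l //.
by apply: fmor_Rpow; rewrite -realize_prj; apply: radn_compl.
Qed.

(** The components of g are expanded with coefficients of degree l. Applying phi to the coefficients
    at t gives a morphism of degree l + d, which [fibre_inj] places in R^(l+d+1); hence it is zero,
    and the coefficients form a syzygy. *)
Lemma fibre_syzygy l Z (T : Type) (ob : T -> C)
    (c : forall t, Mor D Z (F (ob t))) (g : Mor D Z X) : fibre c ->
  radn l g -> radn (l + d).+1 (g \then f0) ->
  exists2 psi : forall t s, Mor C (ob t) (x s), forall t, syzygy l (psi t) &
    eventually (fun ts => radn l.+1 (g - \sum_(t <- ts) (c t \then realize (psi t)))).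
Proof.
move=> hc rg rgf.
have h s := cid2 (fibre_homdeg hc (radn_compl (dprj DX s) rg)).
pose psi t s := s2val (h s) t.
have psi_homdeg t s : homdeg l (psi t s) by apply: (s2valP (h s)).
have ev := eventually_all (fun s => s2valP' (h s)).
exists psi => [t|]; last first.
  apply: eventually_imp ev => ts us hts; apply: (dsum_radn (d := DX)) => s.
  rewrite compBl comp_suml.
  by under eq_bigr do rewrite -compmA realize_prj; apply: hts.
split=> [s|r]; first exact: psi_homdeg.
have [ts [uts tts hts]] := eventually_mem t ev.
apply: (homdeg_eq0 hC (l := l + d)).
  by apply: homdeg_sum => s _; apply: homdeg_comp.
apply: (fibre_inj hc (psi := fun t => \sum_s (psi t s \then phi s r)) uts _ tts).
(* Up to sign, the correction is the error of the expansion, in rad^(l+1), followed by the image of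
   phi, in rad^d. *)
have -> : \sum_(t <- ts) (c t \then fmor F (\sum_s (psi t s \then phi s r))) =
    g \then f0 \then dprj DY r - \sum_s (g \then dprj DX s -
      \sum_(t <- ts) (c t \then fmor F (psi t s))) \then fmor F (phi s r).
  rewrite comp_f0_prj -sumrB.
  under eq_bigr do rewrite fmor_sum comp_sumr.
  rewrite big_exchange; apply: eq_bigr => s _.
  rewrite compBl opprB addrCA subrr addr0 comp_suml.
  by apply: eq_bigr => u _; rewrite fmor_comp compmA.
apply: radnB; first exact: radn_compl.
apply: radn_sum => s _; rewrite -addSn; apply: radn_comp; first exact: hts.
by apply/F_rad/homdeg_Rpow.
Qed.

Record syzygy_family (I : finType) := SyzygyFamily {
  sob : I -> C;
  sdeg : I -> nat;
  smor : forall e s, Mor C (sob e) (x s);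
  ssyz : forall e, syzygy (sdeg e) (smor e);
  sinj : forall e, Mor D (F (sob e)) K;
  sprj : forall e, Mor D K (F (sob e));
  sinj_i : forall e, sinj e \then i = realize (smor e);
  sinj_prj : forall e, sinj e \then sprj e = idmor D (F (sob e));
  sinj_prj0 : forall e e', e != e' -> sinj e \then sprj e' = 0 }.

Section Family.
Variables (I : finType) (E : syzygy_family I).

(** Members of degree above l are treated apart because the truncated difference of degrees would
    allow them coefficients of degree 0. *)
Definition generated l z (psi : forall s, Mor C z (x s)) : Prop :=
  exists rho : forall e, Mor C z (sob E e),
    [/\ forall e, (sdeg E e <= l)%N -> homdeg (l - sdeg E e) (rho e),
        forall e, (l < sdeg E e)%N -> rho e = 0
      & forall s, psi s = \sum_e (rho e \then smor E e s)].

(** If there is a path of length l from z to x s, then R^(l+1) vanishes there, the congruence is an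
    equality, and the nonzero terms already have coefficients of the right degree. Without such a
    path, both sides of the required equation are zero. *)
Lemma generated_upto l z (psi : forall s, Mor C z (x s))
    (rho : forall e, Mor C z (sob E e)) : syzygy l psi ->
  (forall s, Rpow l.+1 (psi s - \sum_e (rho e \then smor E e s))) ->
  generated l psi.
Proof.
move=> [psi_hom _] hrho.
pose rho' e := if (sdeg E e <= l)%N then graded_part (l - sdeg E e) (rho e) else 0.
have rho'_hom e : (sdeg E e <= l)%N -> homdeg (l - sdeg E e) (rho' e).
  by rewrite /rho' => ->; apply: graded_part_homdeg.
have rho'0 e : (l < sdeg E e)%N -> rho' e = 0 by rewrite ltnNge /rho' => /negPf->.
exists rho'; split=> // s.
have [Pl|nPl] := pselect (irr_path l z (x s)).
  suff -> : \sum_e (rho' e \then smor E e s) = \sum_e (rho e \then smor E e s).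
    by apply/eqP; rewrite -subr_eq0; apply/eqP; apply: (path_Rpow_eq0 hC Pl).
  apply: eq_bigr => e _.
  have [->|se0] := pselect (smor E e s = 0); first by rewrite !comp0r.
  have [re0|re0] := pselect (rho e = 0).
    by rewrite /rho' /graded_part re0 !if_same.
  have [a Pa] := nonzero_path hC re0.
  have Pe := (ssyz E e).1 s se0.
  have al := cwl_path hC (irr_path_cat Pa Pe) Pl.
  rewrite /rho' -al leq_addl addnK /graded_part.
  by case: asboolP.
have -> : psi s = 0 by apply: contrapT => /psi_hom.
rewrite big1 // => e _; apply: contrapT => /= ne0; apply: nPl.
have [le|/rho'0 e0] := leqP (sdeg E e) l; last by case: ne0; rewrite e0 comp0l.
by rewrite -(subnK le); apply: (homdeg_comp (rho'_hom e le) ((ssyz E e).1 s)).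
Qed.

(** For indecomposable V one proceeds layer by layer: the remainder is still annihilated exactly by
    [f0], so its leading part is given by syzygies, and these are generated. A resolution of the
    identity reduces general V to this case. *)
Lemma kernel_approx n :
  (forall l z (psi : forall s, Mor C z (x s)), (l < n)%N ->
     syzygy l psi -> generated l psi) ->
  forall V (g : Mor D V X), g \then f0 = 0 ->
  exists beta : forall e, Mor D V (F (sob E e)),
    radn n (g - \sum_e (beta e \then realize (smor E e))).
Proof.
move=> gen V g gf0.
have indec U (h : Mor D U X) : indecomposable U -> h \then f0 = 0 ->
    exists beta : forall e, Mor D U (F (sob E e)),
      radn n (h - \sum_e (beta e \then realize (smor E e))).
  move=> hU hf0; have [[T [ob [c hc]]]|out] := D_fibre hU; last first.
    exists (fun _ => 0); apply: radnB; last first.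
      by apply: radn_sum => e _; rewrite comp0l; apply: radn0.
    elim: (n) => [//|m IH]; apply: (dsum_radn (d := DX)) => s.
    by apply: out; apply: radn_compl.
  elim: n gen => [|m IH] gen; first by exists (fun _ => 0).
  have [l z psi lm|beta hbeta] := IH; first by apply: gen; apply: ltnW.
  set h' := h - _ in hbeta.
  have h'f0 : h' \then f0 = 0.
    rewrite compBl hf0 comp_suml big1 ?subr0 // => e _.
    by rewrite -compmA (realize_f0 (ssyz E e)) comp0r.
  have [|psi syz_psi ev] := fibre_syzygy (l := m) hc hbeta.
    by rewrite h'f0; apply: radn0.
  have [ts _ hts] := eventually_ex ev.
  have hgen t := cid (gen m _ (psi t) (ltnSn m) (syz_psi t)).
  pose rho t := sval (hgen t).
  have psiE t s : psi t s = \sum_e (rho t e \then smor E e s).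
    by have [_ _] := svalP (hgen t); apply.
  exists (fun e => beta e + \sum_(t <- ts) (c t \then fmor F (rho t e))).
  under eq_bigr do rewrite compDl.
  rewrite big_split opprD addrA -/h'.
  suff -> : \sum_e ((\sum_(t <- ts) (c t \then fmor F (rho t e))) \then
      realize (smor E e)) = \sum_(t <- ts) (c t \then realize (psi t)) by [].
  under eq_bigr do rewrite comp_suml.
  rewrite -big_exchange; apply: eq_bigr => t _.
  under eq_bigr do rewrite -compmA realize_comp.
  rewrite -comp_sumr; congr (_ \then _); rewrite exchange_big /=.
  by apply: eq_bigr => s _; rewrite -comp_suml -fmor_sum psiE.
have [J [U [p [j [hU pj]]]]] := indecomposable_resolution findimD V.
have hj a : (j a \then g) \then f0 = 0 by rewrite -compmA gf0 comp0r.
have hbeta a := cid (indec _ (j a \then g) (hU a) (hj a)).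
pose beta a := sval (hbeta a).
exists (fun e => \sum_a (p a \then beta a e)).
rewrite -[g]comp_idl -pj comp_suml.
under [X in _ - X]eq_bigr do rewrite comp_suml.
rewrite exchange_big -sumrB; apply: radn_sum => a _.
under eq_bigr do rewrite -compmA.
rewrite -compmA -comp_sumr -compBr; apply: radn_compr.
exact: (svalP (hbeta a)).
Qed.

(** The coefficients gamma need not come from C. Expanding them along the fibre over F z and
    comparing the terms at the distinguished member yields coefficients that do. *)
Lemma generated_of_approx l z (psi : forall s, Mor C z (x s))
    (gamma : forall e, Mor D (F z) (F (sob E e))) : syzygy l psi ->
  radn l.+1 (realize psi - \sum_e (gamma e \then realize (smor E e))) ->
  generated l psi.
Proof.
move=> syz_psi hg.
have [T [ob [c [hc [t0 [et0 ct0]]]]]] := F_fibre z; subst z.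
have h e := cid (fibre_approx hc l.+1 (gamma e)).
pose rho t e := sval (h e) t.
have [ts [uts t0ts hts]] := eventually_mem t0 (eventually_all (fun e => svalP (h e))).
apply: (generated_upto (rho := rho t0)) => // s.
pose chi t := single (V := fun t => Mor C (ob t) (x s)) (psi s) t -
  \sum_e (rho t e \then smor E e s).
suff rchi : radn l.+1 (\sum_(t <- ts) (c t \then fmor F (chi t))).
  by have := fibre_inj hc uts rchi t0ts; rewrite /chi single_eq.
have -> : \sum_(t <- ts) (c t \then fmor F (chi t)) =
    (realize psi - \sum_e (gamma e \then realize (smor E e))) \then dprj DX s +
    \sum_e (gamma e - \sum_(t <- ts) (c t \then fmor F (rho t e)))
      \then fmor F (smor E e s).
  rewrite compBl realize_prj comp_suml.
  under [X in _ - X]eq_bigr do rewrite -compmA realize_prj.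
  under [X in _ + X]eq_bigr do rewrite compBl.
  rewrite sumrB addrA subrK.
  under eq_bigr do rewrite /chi fmorB compBr.
  rewrite sumrB; congr (_ - _).
    rewrite (big_In1 (t0 := t0)) // => [|t tt0]; first by rewrite single_eq ct0 comp_idl.
    by rewrite single_neq // fmor0 comp0r.
  under eq_bigr do rewrite fmor_sum comp_sumr.
  rewrite big_exchange; apply: eq_bigr => e _; rewrite comp_suml.
  by apply: eq_bigr => t _; rewrite fmor_comp compmA.
apply: radnD; first exact: radn_compl.
by apply: radn_sum => e _; apply: radn_compl; apply: (hts e).
Qed.

(** The test is whether v, after removal of its components along the family, is radical. If it is
    not, it is a split monomorphism because F z is indecomposable. *)
Lemma family_extend l z (psi : forall s, Mor C z (x s)) (v : Mor D (F z) K) :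
  syzygy l psi -> v \then i = realize psi ->
  inhabited (syzygy_family (option I)) \/
  exists alpha : forall e, Mor D (F z) (F (sob E e)),
    radn 1 (v - \sum_e (alpha e \then sinj E e)).
Proof.
move=> syz_psi vi; pose v' := v - \sum_e (v \then sprj E e \then sinj E e).
have [rv'|nrv'] := pselect (radn 1 v').
  by right; exists (fun e => v \then sprj E e).
left; have [q v'q] := not_rad_split findimD (F_indec z) nrv'.
have v'p e : v' \then sprj E e = 0.
  rewrite compBl comp_suml (bigD1 e) //= big1 => [|e' e'e].
    by rewrite addr0 -compmA sinj_prj comp_idr subrr.
  by rewrite -compmA sinj_prj0 // comp0r.
pose q' := q - \sum_e (sprj E e \then (sinj E e \then q)).
have uq' e : sinj E e \then q' = 0.
  rewrite compBr comp_sumr (bigD1 e) //= big1 => [|e' e'e].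
    by rewrite addr0 compmA sinj_prj comp_idl subrr.
  by rewrite compmA sinj_prj0 1?eq_sym // comp0l.
have v'q' : v' \then q' = idmor D (F z).
  rewrite compBr v'q comp_sumr big1 ?subr0 // => e _.
  by rewrite compmA v'p comp0l.
have vq' : v \then q' = idmor D (F z).
  rewrite -v'q' compBl comp_suml [X in _ - X]big1 ?subr0 // => e _.
  by rewrite -compmA uq' comp0r.
pose o (e : option I) := if e is Some e then sob E e else z.
pose m (e : option I) : forall s, Mor C (o e) (x s) :=
  match e with Some e => smor E e | None => psi end.
(* The new inclusion is v and not [v'], since it is v that lifts [realize psi]; orthogonality is
   restored by correcting the old projections. *)
pose u (e : option I) : Mor D (F (o e)) K :=
  match e with Some e => sinj E e | None => v end.
pose p (e : option I) : Mor D K (F (o e)) :=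
  match e with
  | Some e => sprj E e - q' \then (v \then sprj E e)
  | None => q'
  end.
pose deg (e : option I) := if e is Some e then sdeg E e else l.
constructor; apply: (@SyzygyFamily _ o deg m _ u p).
- by case=> [e|] //=; apply: ssyz.
- by case=> [e|] //=; apply: sinj_i.
- by case=> [e|] //=; rewrite compBr compmA uq' comp0l subr0 sinj_prj.
- case=> [e|] [e'|] //=; first last.
  + by rewrite compBr (compmA v) vq' comp_idl subrr.
  + by move=> ee'; rewrite compBr compmA uq' comp0l subr0 sinj_prj0.
Qed.

End Family.

(** The members give nonzero orthogonal idempotents of K, so their number is bounded. *)
Lemma maximal_family : exists (I : finType) (E : syzygy_family I),
  ~ inhabited (syzygy_family (option I)).
Proof.
have [N hN] := orthogonal_idempotents_bound findimD K.
have bound I : syzygy_family I -> (#|I| <= N)%N.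
  move=> E; apply: (hN I (fun e => sprj E e \then sinj E e)).
  - move=> e pu0; apply: (F_indec (sob E e)).1; rewrite /is_zero.
    have <- : sinj E e \then (sprj E e \then sinj E e) \then sprj E e =
      idmor D (F (sob E e)) by rewrite compmA sinj_prj comp_idl sinj_prj.
    by rewrite pu0 comp0r comp0l.
  - by move=> e; rewrite comp_cancel // sinj_prj.
  - by move=> e e' ee'; rewrite comp_vanish // sinj_prj0.
pose P n := `[< exists2 I : finType, #|I| = n & inhabited (syzygy_family I) >].
have exP : exists n, P n.
  exists 0%N; apply/asboolP; exists void; first exact: card_void.
  constructor; apply: (@SyzygyFamily void (fun e => match e with end)
    (fun e => match e with end) (fun e => match e with end) _
    (fun e => match e with end) (fun e => match e with end)); by case.
have leP n : P n -> (n <= N)%N by move=> /asboolP[I <- []]; apply: bound.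
have [n /asboolP[I cI [E]] nmax] := ex_maxnP exP leP.
exists I, E => E'; have h : P #|{: option I}| by apply/asboolP; exists (option I).
by have := nmax _ h; rewrite card_option cI ltnn.
Qed.

(** By maximality the lift v of psi is a combination of the family up to a radical error r. By
    induction on the degree, [kernel_approx] applied to i itself approximates i modulo rad^l; so r
    followed by i is a combination modulo rad^(l+1), which is the precision needed in degree l. *)
Lemma maximal_family_generates I (E : syzygy_family I) :
  ~ inhabited (syzygy_family (option I)) ->
  forall l z (psi : forall s, Mor C z (x s)), syzygy l psi -> generated E l psi.
Proof.
move=> Emax; elim/ltn_ind => l IH z psi syz_psi.
have [v vi] := i_univ (realize_f0 syz_psi).
have [//|[alpha ralpha]] := family_extend E syz_psi vi.
have [] := @kernel_approx I E l _ K i i_f0.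
  by move=> l' z' psi' l'l; apply: IH.
move=> beta rbeta; set r := v - _ in ralpha.
apply: (generated_of_approx (gamma := fun e => alpha e + r \then beta e)) => //.
have -> : realize psi - \sum_e ((alpha e + r \then beta e) \then
    realize (smor E e)) = r \then (i - \sum_e (beta e \then realize (smor E e))).
  under eq_bigr do rewrite compDl.
  rewrite big_split opprD addrA compBr comp_sumr; congr (_ - _); last first.
    by apply: eq_bigr => e _; rewrite compmA.
  rewrite compBl vi comp_suml; congr (_ - _).
  by apply: eq_bigr => e _; rewrite -compmA sinj_i.
by rewrite -add1n; apply: radn_comp.
Qed.

(** Expanding eta along the fibre turns the congruence into an exact relation over C. Its image
    under F can be lifted from X to K because i is mono, and there the projections of the family
    kill every leading coefficient. *)
Lemma family_free I (E : syzygy_family I) l Z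
    (eta : forall e, Mor D Z (F (sob E e))) : indecomposable Z ->
  (forall e, (sdeg E e <= l)%N -> radn (l - sdeg E e) (eta e)) ->
  radn l.+1 (\sum_(e | (sdeg E e <= l)%N) (eta e \then realize (smor E e))) ->
  forall e, (sdeg E e <= l)%N -> radn (l - sdeg E e).+1 (eta e).
Proof.
move=> hZ reta rsum; have [[T [ob [c hc]]]|out] := D_fibre hZ; last first.
  by move=> e el; apply: out; apply: reta.
(* When the degree of e exceeds l the difference is 0 and the claim is void, so all e can be
   expanded uniformly. *)
have reta' e : radn (l - sdeg E e) (eta e).
  have [/reta//|/ltnW] := leqP (sdeg E e) l.
  by rewrite /leq => /eqP->.
have h e := cid2 (fibre_homdeg hc (reta' e)).
pose rho t e := s2val (h e) t.
have rho_hom t e : homdeg (l - sdeg E e) (rho t e) by apply: (s2valP (h e)).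
have [ts uts hts] := eventually_ex (eventually_all (fun e => s2valP' (h e))).
have rho_syz s t : List.In t ts ->
    \sum_(e | (sdeg E e <= l)%N) (rho t e \then smor E e s) = 0.
  move=> tts; apply: (homdeg_eq0 hC (l := l)).
    apply: homdeg_sum => e el; rewrite -(subnK el).
    exact: (homdeg_comp (rho_hom t e) ((ssyz E e).1 s)).
  pose chi t := \sum_(e | (sdeg E e <= l)%N) (rho t e \then smor E e s).
  apply: (fibre_inj hc (psi := chi) uts _ tts).
  have -> : \sum_(t <- ts) (c t \then fmor F (chi t)) =
      (\sum_(e | (sdeg E e <= l)%N) (eta e \then realize (smor E e))) \then dprj DX s -
      \sum_(e | (sdeg E e <= l)%N)
        (eta e - \sum_(t <- ts) (c t \then fmor F (rho t e))) \then fmor F (smor E e s).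
    rewrite comp_suml; under [X in X - _]eq_bigr do rewrite -compmA realize_prj.
    rewrite -sumrB; under [RHS]eq_bigr do rewrite compBl opprB addrCA subrr addr0 comp_suml.
    rewrite -big_exchange; apply: eq_bigr => u _; rewrite fmor_sum comp_sumr.
    by apply: eq_bigr => e _; rewrite fmor_comp compmA.
  apply: radnB; first exact: radn_compl.
  apply: radn_sum => e el.
  rewrite -[in radn _](subnK el) -addSn; apply: radn_comp; first exact: (hts e).
  exact: (F_rad (homdeg_Rpow hC ((ssyz E e).1 s))).
have rho0 t e : List.In t ts -> (sdeg E e <= l)%N -> fmor F (rho t e) = 0.
  move=> tts el.
  have : \sum_(e | (sdeg E e <= l)%N) (fmor F (rho t e) \then sinj E e) = 0.
    apply: i_mono; rewrite comp0l comp_suml.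
    under eq_bigr do rewrite -compmA sinj_i realize_comp.
    rewrite exchange_big big1 // => s _ /=.
    by rewrite -comp_suml -fmor_sum rho_syz // fmor0 comp0l.
  move=> /(congr1 (fun f => f \then sprj E e)).
  rewrite comp0l comp_suml (bigD1 e) //= big1 => [|e' /andP[_ e'e]].
    by rewrite addr0 -compmA sinj_prj comp_idr.
  by rewrite -compmA sinj_prj0 // comp0r.
move=> e el; have := hts e; rewrite big_In0 ?subr0 // => t tts.
by rewrite rho0 // comp0r.
Qed.

(** An arbitrary complement is moved by a combination of the family that approximates its map to
    X. *)
Lemma family_complement I (E : syzygy_family I) :
  (forall l z (psi : forall s, Mor C z (x s)), syzygy l psi -> generated E l psi) ->
  exists (K' : D) (j : Mor D K' K) (q : Mor D K K')
    (p : forall e, Mor D K (F (sob E e))),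
  [/\ (forall e, sinj E e \then p e = idmor D (F (sob E e))) /\
       (forall e e', e != e' -> sinj E e \then p e' = 0),
      (forall e, sinj E e \then q = 0) /\ (forall e, j \then p e = 0),
      j \then q = idmor D K',
      \sum_e (p e \then sinj E e) + q \then j = idmor D K
    & rad_inf (j \then i)].
Proof.
move=> gen; pose pi := \sum_e (sprj E e \then sinj E e).
have spi e : sinj E e \then pi = sinj E e.
  rewrite comp_sumr (bigD1 e) //= big1 => [|e' e'e].
    by rewrite addr0 compmA sinj_prj comp_idl.
  by rewrite compmA sinj_prj0 ?comp0l // eq_sym.
have pis e : pi \then sprj E e = sprj E e.
  rewrite comp_suml (bigD1 e) //= big1 => [|e' e'e].
    by rewrite addr0 -compmA sinj_prj comp_idr.
  by rewrite -compmA sinj_prj0 ?comp0r.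
have pipi : pi \then pi = pi.
  by rewrite {1}/pi comp_suml; apply: eq_bigr => e _; rewrite -compmA spi.
have [|K' [j [q [jq qj]]]] := @splitD K (idmor D K - pi).
  by rewrite compBl !compBr !comp_idl comp_idr pipi subrr subr0.
have sq e : sinj E e \then q = 0.
  rewrite -[q]comp_idr -jq (compmA q) qj compmA compBr comp_idr spi subrr.
  by rewrite comp0l.
have js e : j \then sprj E e = 0.
  by rewrite -[j]comp_idl -jq -(compmA j) qj -compmA compBl comp_idl pis subrr comp0r.
(* On morphisms from [K'] to X the power N of the radical is already rad^oo, so a single
   approximation suffices. *)
have [N hN] := radn_stable findimD K' X.
have jif0 : j \then i \then f0 = 0 by rewrite -compmA i_f0 comp0r.
have [//|beta hbeta] := @kernel_approx I E N _ K' (j \then i) jif0.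
  by move=> l z psi _; apply: gen.
pose j' := j - \sum_e (beta e \then sinj E e).
(* The projections onto the family are corrected so as to vanish on the moved complement. *)
exists K', j', q, (fun e => sprj E e + q \then beta e).
have betasq : (\sum_e (beta e \then sinj E e)) \then q = 0.
  by rewrite comp_suml big1 // => e _; rewrite -compmA sq comp0r.
split.
- split=> [e|e e' ee']; rewrite compDr compmA sq comp0l addr0 ?sinj_prj //.
  exact: sinj_prj0.
- split=> // e; rewrite compDr !compBl js sub0r (compmA j) jq comp_idl.
  rewrite (compmA _ q) betasq comp0l subr0 comp_suml (bigD1 e) //= big1 => [|e' e'e].
    by rewrite addr0 -compmA sinj_prj comp_idr addNr.
  by rewrite -compmA sinj_prj0 // comp0r.
- by rewrite compBl jq betasq subr0.
- under eq_bigr do rewrite compDl.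
  rewrite big_split -/pi compBr qj comp_sumr.
  under eq_bigr do rewrite -compmA.
  by rewrite addrACA subrr addr0 addrC subrK.
apply: hN; rewrite compBl comp_suml.
by under eq_bigr do rewrite -compmA sinj_i.
Qed.

Section Layers.
Variables (f : Mor D X Y) (I : finType) (E : syzygy_family I).
Hypothesis f_radn : radn d f.
Hypothesis f_f0 : radn d.+1 (f - f0).
Hypothesis gen : forall l z (psi : forall s, Mor C z (x s)),
  syzygy l psi -> generated E l psi.

Lemma radn_comp_congr l Z (g : Mor D Z X) : radn l g ->
  (radn (l + d).+1 (g \then f) <-> radn (l + d).+1 (g \then f0)).
Proof.
move=> rg; have h : radn (l + d).+1 (g \then f - g \then f0).
  by rewrite -compBr -addnS; apply: radn_comp.
split=> r; last exact: radn_congr h r.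
by rewrite -[_ \then f0](subKr (g \then f)); apply: radnB.
Qed.

Lemma layer_factor l Z (g : Mor D Z X) : indecomposable Z ->
  radn l g -> radn (l + d).+1 (g \then f) ->
  exists beta : forall e, Mor D Z (F (sob E e)),
    [/\ forall e, (sdeg E e <= l)%N -> radn (l - sdeg E e) (beta e),
        forall e, (l < sdeg E e)%N -> beta e = 0
      & radn l.+1 (g - \sum_e (beta e \then realize (smor E e)))].
Proof.
move=> hZ rg /(radn_comp_congr rg) rgf.
have [[T [ob [c hc]]]|out] := D_fibre hZ; last first.
  exists (fun _ => 0); split=> // [e _|]; first exact: radn0.
  rewrite big1 ?subr0 => [|e _]; last by rewrite comp0l.
  by apply: (dsum_radn (d := DX)) => s; apply: out; apply: radn_compl.
have [psi syz_psi ev] := fibre_syzygy hc rg rgf.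
have [ts _ hts] := eventually_ex ev.
have hgen t := cid (gen (syz_psi t)).
pose rho t := sval (hgen t).
exists (fun e => \sum_(t <- ts) (c t \then fmor F (rho t e))); split=> [e el|e le|].
- apply: radn_sum => t _; apply: radn_compr; apply: F_rad; apply: (homdeg_Rpow hC).
  by have [h _ _] := svalP (hgen t); apply: h.
- apply: big1 => t _; have [_ h _] := svalP (hgen t).
  by rewrite /rho h // fmor0 comp0r.
suff -> : \sum_e ((\sum_(t <- ts) (c t \then fmor F (rho t e))) \then
    realize (smor E e)) = \sum_(t <- ts) (c t \then realize (psi t)) by [].
under eq_bigr do rewrite comp_suml.
rewrite -big_exchange; apply: eq_bigr => t _.
under eq_bigr do rewrite -compmA realize_comp.
rewrite -comp_sumr; congr (_ \then _); rewrite exchange_big /=.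
apply: eq_bigr => s _; rewrite -comp_suml -fmor_sum.
by have [_ _ ->] := svalP (hgen t).
Qed.

(** One degree deeper it would be zero, and then so would the split monomorphism [sinj E e]. *)
Lemma smor_in_layer e : in_layer (sdeg E e) (realize (smor E e)).
Proof.
split; first exact: realize_radn (ssyz E e).
move=> /(realize_eq0 (ssyz E e)); rewrite -(sinj_i E e) -(comp0l _ i).
move=> /i_mono u0; apply: (F_indec (sob E e)).1.
by rewrite /is_zero -(sinj_prj E e) u0 comp0l.
Qed.

Lemma sdeg_left_degree e : left_degree_witness d f (sdeg E e).
Proof.
exists (F (sob E e)), (realize (smor E e)); split; first exact: F_indec.
  exact: smor_in_layer.
apply/(radn_comp_congr (realize_radn (ssyz E e))).
by rewrite (realize_f0 (ssyz E e)); apply: radn0.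
Qed.

Variable n : nat.
Hypothesis f_degree : has_left_degree d f n.

Lemma sdeg_ge e : (n <= sdeg E e)%N.
Proof. by have [_] := f_degree; apply; apply: sdeg_left_degree. Qed.

(** All members have degree at least n. If none had degree n, a witness of the left degree would
    have only zero coefficients in [layer_factor] and lie in rad^(n+1). *)
Lemma sdeg_ex : exists e, sdeg E e = n.
Proof.
have [[Z [g [hZ [rg nrg] rgf]]] _] := f_degree.
apply: contrapT => /forallNP ne; apply: nrg.
have [beta [_ beta0]] := layer_factor hZ rg rgf.
rewrite big1 ?subr0 // => e _; rewrite beta0 ?comp0l //.
by rewrite ltn_neqAle sdeg_ge andbT eq_sym; apply/eqP/ne.
Qed.

Lemma kernel_layers : in_layer n i /\
  exists (K_ : option nat -> D) (DK : dsum K K_),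
    [/\ forall m, (m < n)%N -> is_zero (K_ (Some m)),
        forall m, (n <= m)%N ->
          forall (U : bool -> D) (DU : dsum (K_ (Some m)) U),
          indecomposable (U true) ->
          in_layer m (dinj DU true \then dinj DK (Some m) \then i),
        forall (U : bool -> D) (DU : dsum (K_ None) U),
          indecomposable (U true) ->
          rad_inf (dinj DU true \then dinj DK None \then i)
      & forall (l : nat) (Z : D), (n <= l)%N -> indecomposable Z ->
          exact_layers d n l Z (fun m => dinj DK (Some m) \then i) f].
Proof.
have [K' [j [q [p [[up up0] [uq jp] jq idK ji]]]]] := family_complement gen.
pose u e := sinj E e; pose g e := realize (smor E e).
have ui e : u e \then i = g e by apply: sinj_i.
pose pi m := \sum_(e | sdeg E e == m) (p e \then u e).
have upi e : u e \then pi (sdeg E e) = u e.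
  rewrite comp_sumr (bigD1 e) //= big1 => [|e' /andP[_ e'e]].
    by rewrite addr0 compmA up comp_idl.
  by rewrite compmA up0 ?comp0l // eq_sym.
have upi0 e m : sdeg E e != m -> u e \then pi m = 0.
  move=> em; rewrite comp_sumr big1 // => e' /eqP e'm.
  rewrite compmA up0 ?comp0l //; apply: contraNneq em => ->.
  exact/eqP.
have pipi m : pi m \then pi m = pi m.
  rewrite {1}/pi comp_suml; apply: eq_bigr => e /eqP <-.
  by rewrite -compmA upi.
have pipi0 m m' : m != m' -> pi m \then pi m' = 0.
  move=> mm'; rewrite {1}/pi comp_suml big1 // => e /eqP em.
  by rewrite -compmA upi0 ?comp0r // em.
have piq m : pi m \then q = 0.
  by rewrite comp_suml big1 // => e _; rewrite -compmA uq comp0r.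
have jpi m : j \then pi m = 0.
  by rewrite comp_sumr big1 // => e _; rewrite compmA jp comp0l.
(* K^(m) is cut out of K by an idempotent instead of being built as a sum of the F z_e: the ambient
   category is only assumed to split idempotents. *)
have hsplit m := cid (splitD (pipi m)).
pose Km m := sval (hsplit m).
have hv m := cid (svalP (hsplit m)).
pose v m : Mor D (Km m) K := sval (hv m).
have hw m := cid (svalP (hv m)).
pose w m : Mor D K (Km m) := sval (hw m).
have vw m : v m \then w m = idmor D (Km m) by have [] := svalP (hw m).
have wv m : w m \then v m = pi m by have [] := svalP (hw m).
have vpi m : v m \then pi m = v m by rewrite -wv compmA vw comp_idl.
have piw m : pi m \then w m = w m by rewrite -wv -compmA vw comp_idr.
clearbody v w.
pose K_ (o : option nat) := if o is Some m then Km m else K'.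
pose a (o : option nat) : Mor D (K_ o) K :=
  match o return Mor D (K_ o) K with Some m => v m | None => j end.
pose b (o : option nat) : Mor D K (K_ o) :=
  match o return Mor D K (K_ o) with Some m => w m | None => q end.
have ab o : a o \then b o = idmor D (K_ o) by case: o.
have ab0 o o' : o != o' -> a o \then b o' = 0.
  case: o o' => [m|] [m'|] //= oo'.
  - rewrite -vpi -piw compmA -(compmA (v m)) pipi0 ?comp0r ?comp0l //.
  - by rewrite -vpi -compmA piq comp0r.
  - by rewrite -piw compmA jpi comp0l.
pose r := undup [seq sdeg E e | e <- enum I].
have zero m : (forall e, sdeg E e != m) -> is_zero (Km m).
  move=> hm; rewrite /is_zero -vw -vpi /pi big_pred0 ?comp0r ?comp0l // => e.
  exact/negbTE.
have sum_id : exists s : seq (option nat),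
    [/\ uniq s, forall o, o \notin s -> is_zero (K_ o)
      & \sum_(o <- s) (b o \then a o) = idmor D K].
  exists (None :: [seq Some m | m <- r]); split.
  - rewrite /= map_inj_uniq ?undup_uniq ?andbT; last by move=> m m' [].
    by apply/mapP => -[].
  - case=> [m|]; last by rewrite mem_head.
    rewrite inE /= mem_map; last by move=> m1 m2 [].
    rewrite mem_undup => mr; apply: zero => e; apply: contraNneq mr => <-.
    by rewrite map_f ?mem_enum.
  rewrite big_cons big_map /=; under eq_bigr do rewrite wv.
  rewrite sum_by_degree ?undup_uniq // addrC -idK; congr (_ + _).
  by apply: eq_bigl => e; rewrite mem_undup map_f ?mem_enum.
pose DK := DSum ab ab0 sum_id.
have g_layer e : in_layer (sdeg E e) (g e) by apply: smor_in_layer.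
have v_radn m : radn m (v m \then i).
  rewrite -vpi comp_sumr comp_suml; apply: radn_sum => e /eqP <-.
  by rewrite -!compmA ui; do 2!apply: radn_compr; case: (g_layer e).
have free l Z (h : forall m, Mor D Z (Km m)) : indecomposable Z ->
    (forall m, (n <= m <= l)%N -> radn (l - m) (h m)) ->
    radn l.+1 (\sum_(n <= m < l.+1) (h m \then (v m \then i))) ->
    forall m, (n <= m <= l)%N -> radn (l - m).+1 (h m).
  move=> hZ rh rsum.
  (* These are the coordinates of all the h m along the family; they translate injectivity for the
     K^(m) into [family_free]. *)
  pose eta e : Mor D Z (F (sob E e)) := h (sdeg E e) \then v (sdeg E e) \then p e.
  have hvi m : h m \then (v m \then i) = \sum_(e | sdeg E e == m) (eta e \then g e).
    rewrite -vpi comp_sumr comp_suml comp_sumr; apply: eq_bigr => e /eqP em.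
    by subst m; rewrite /eta -ui !compmA.
  have h_eta m : h m = \sum_(e | sdeg E e == m) (eta e \then u e \then w m).
    rewrite -[LHS]comp_idr -vw -{1}vpi comp_sumr comp_suml comp_sumr.
    by apply: eq_bigr => e /eqP em; subst m; rewrite /eta !compmA.
  have reta e : (sdeg E e <= l)%N -> radn (l - sdeg E e).+1 (eta e).
    move: e; apply: (family_free (E := E)) => //.
      move=> e el; rewrite /eta -compmA; apply: radn_compl.
      by apply: rh; rewrite sdeg_ge.
    move: rsum; under eq_bigr do rewrite hvi.
    rewrite sum_by_degree ?iota_uniq // (eq_bigl (fun e => sdeg E e <= l)%N) // => e.
    by rewrite mem_index_iota sdeg_ge.
  move=> m /andP[_ ml]; rewrite h_eta; apply: radn_sum => e /eqP em.
  by apply/radn_compl/radn_compl; rewrite -em; apply: reta; rewrite em.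
split.
  split; last first.
    have [e <-] := sdeg_ex => ri; have [_] := g_layer e; apply.
    by rewrite -ui; apply: radn_compr.
  rewrite -[i]comp_idl -idK compDl comp_suml; apply: radnD.
    apply: radn_sum => e _; rewrite -compmA ui; apply: radn_compr.
    by apply: radn_le (sdeg_ge e) _; case: (g_layer e).
  by rewrite -compmA; apply/radn_compr/ji.
exists K_, DK; split.
- move=> m mn; apply: zero => e; rewrite neq_ltn (leq_trans mn) ?orbT //.
  exact: sdeg_ge.
- move=> m nm U DU hU; split; first by rewrite -compmA; apply/radn_compr/v_radn.
  (* Injectivity at l = m, for the family concentrated in m, would make the inclusion of the summand
     radical, and with it the identity of an indecomposable. *)
  move=> rl; apply: (rad_noninvertible findimD splitD hU hU); last exact: (invertible_id (U true)).
  rewrite -(inj_prj DU true); apply: radn_compl.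
  pose h m' := dfwith (fun m => 0 : Mor D (U true) (Km m)) (dinj DU true : Mor D _ (Km m)) m'.
  have hm : h m = dinj DU true by rewrite /h dfwith_in.
  suff : radn (m - m).+1 (h m) by rewrite hm subnn.
  apply: (free m) => //; last by rewrite nm leqnn.
    move=> m' _; rewrite /h; case: dfwithP => [|m'' _]; last exact: radn0.
    by rewrite subnn.
  rewrite (bigD1_seq m) ?iota_uniq ?mem_index_iota ?nm ?ltnSn //= hm big1 ?addr0.
    by rewrite compmA.
  by move=> m' m'm; rewrite /h dfwith_out ?comp0l // eq_sym.
- by move=> U DU _ l; rewrite -compmA; apply: radn_compr; apply: ji.
- move=> l Z nl hZ; split.
  + move=> m h /andP[nm ml]; split=> rh.
      by rewrite -(subnK ml); apply: radn_comp.
    by rewrite -(subnK ml) -addSn; apply: radn_comp.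
  + by move=> h; split=> rh; [|rewrite -addSn]; apply: radn_comp.
  + by move=> h; apply: free.
  move=> h rh; split=> [rhf|[h' rh' rhh']].
    have [beta [rbeta beta0 hbeta]] := layer_factor hZ rh rhf.
    exists (fun m => \sum_(e | sdeg E e == m) (beta e \then u e \then w m)).
      move=> m /andP[_ ml]; apply: radn_sum => e /eqP em.
      by do 2!apply: radn_compl; rewrite -em; apply: rbeta; rewrite em.
    suff -> : \sum_(n <= m < l.+1) ((\sum_(e | sdeg E e == m)
        (beta e \then u e \then w m)) \then (v m \then i)) =
        \sum_e (beta e \then g e) by [].
    rewrite (eq_bigr (fun m => \sum_(e | sdeg E e == m) (beta e \then g e))).
      rewrite sum_by_degree ?iota_uniq // [RHS](bigID (fun e => sdeg E e <= l)%N) /=.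
      rewrite [X in _ = _ + X]big1 ?addr0 => [|e]; last first.
        by rewrite -ltnNge => /beta0->; rewrite comp0l.
      by apply: eq_bigl => e; rewrite mem_index_iota sdeg_ge.
    move=> m _; rewrite comp_suml; apply: eq_bigr => e /eqP <-.
    by rewrite -compmA (compmA (w _)) wv compmA -(compmA (beta e)) upi -compmA ui.
  (* Replacing f by [f0] is harmless at this order, and [f0] annihilates exactly the part of h that
     factors through K. *)
  apply/(radn_comp_congr rh).
  have -> : h \then f0 = (h - \sum_(n <= m < l.+1) (h' m \then (v m \then i))) \then f0.
    rewrite compBl comp_suml big1 ?subr0 // => m _.
    by rewrite -!compmA i_f0 !comp0r.
  rewrite -addSn; apply: radn_comp => //.
  by rewrite -[f0](subKr f); apply: radnB => //; apply: radn_le f_f0.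
Qed.

End Layers.

End Kernel.

End HomogeneousKernel.


(** * The category of modules *)

Section LinearAlgebra.
Variable k : fieldType.

Lemma linear_relation (I : finType) (v : 'I_#|I|.+1 -> I -> k) :
  exists c : 'I_#|I|.+1 -> k,
    (exists i, c i != 0) /\ forall x, \sum_i c i * v i x = 0.
Proof.
pose M := \matrix_(i < #|I|.+1, j < #|I|) v i (enum_val j).
have : kermx M != 0.
  by rewrite -mxrank_eq0 mxrank_ker -lt0n subn_gt0 ltnS rank_leq_col.
move=> /rowV0Pn[u /sub_kermxP uM u0]; exists (u 0); split.
  by have /rV0Pn := u0.
move=> x; transitivity ((u *m M) 0 (enum_rank x)); last by rewrite uM mxE.
by rewrite mxE; apply: eq_bigr => i _; rewrite mxE enum_rankK.
Qed.

(** B has maximal rank among the matrices whose row space is contained in P; a vector of P outside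
    it would increase the rank. *)
Lemma subspace_rowspace n (P : 'rV[k]_n -> Prop) : P 0 ->
  (forall u v, P u -> P v -> P (u + v)) -> (forall c u, P u -> P (c *: u)) ->
  exists B : 'M[k]_n, forall u, P u <-> (u <= B)%MS.
Proof.
move=> P0 PD PZ.
pose Q r := `[< exists B : 'M[k]_n, \rank B = r /\ forall u : 'rV_n, (u <= B)%MS -> P u >].
have exQ : exists r, Q r.
  exists 0%N; apply/asboolP; exists 0; rewrite mxrank0; split=> // u.
  by rewrite submx0 => /eqP->.
have leQ r : Q r -> (r <= n)%N by move=> /asboolP[B [<- _]]; apply: rank_leq_row.
have [r /asboolP[B [rB BP]] rmax] := ex_maxnP exQ leQ.
exists B => u; split; last exact: BP.
move=> Pu; apply: contrapT => /negP nuB.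
have lt : (B < B + u)%MS.
  rewrite ltmxE addsmxSl /=; apply: contra nuB; apply: submx_trans.
  exact: addsmxSr.
have : Q (\rank (B + u)%MS).
  apply/asboolP; exists (B + u)%MS; split=> // v /sub_addsmxP[[a b] /= ->].
  apply: PD; first by apply: BP; apply: submxMl.
  by rewrite [b]mx11_scalar mul_scalar_mx; apply: PZ.
by move=> /rmax; rewrite leqNgt -rB rank_ltmx.
Qed.

End LinearAlgebra.

Lemma fin_gen_ord (R : nzRingType) (M : lmodType R) n (t : 'I_n -> M) :
  (forall x, exists c : 'I_n -> R, x = \sum_i c i *: t i) -> fin_gen M.
Proof.
move=> ht; have e : size [seq t i | i <- enum 'I_n] = n by rewrite size_map size_enum_ord.
exists [seq t i | i <- enum 'I_n] => x; have [c ->] := ht x.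
exists (fun j => c (cast_ord e j)).
rewrite (reindex (cast_ord e)) /=; last first.
  by apply: onW_bij; exists (cast_ord (esym e)) => i; apply: val_inj.
apply: eq_bigr => j _; congr (_ *: _).
rewrite (nth_map (cast_ord e j)) ?size_enum_ord -?[X in (_ < X)%N]e //.
by congr t; apply: val_inj; rewrite /= nth_enum_ord // -[X in (_ < X)%N]e.
Qed.

Section ModuleCategory.
Variables (k : fieldType) (A : falgType k).
Implicit Types X Y Z K : fgmod A.

Lemma modhom_sum X Y J (r : seq J) (P : pred J) (f : J -> modhom X Y) x :
  modhom_fun (\sum_(j <- r | P j) f j) x = \sum_(j <- r | P j) modhom_fun (f j) x.
Proof. exact: (big_morph (fun f => modhom_fun f x)). Qed.

Lemma fgmod_kspan X : exists (I : finType) (w : I -> X),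
  forall x, exists c : I -> k, x = \sum_i (c i)%:A *: w i.
Proof.
have [s hs] := fgmod_fin_gen X.
pose b := vbasis {:A}.
pose J := ('I_(size s) * 'I_(\dim {:A}))%type.
exists J, (fun ij : J => b`_ij.2 *: s`_ij.1) => x.
have [c ->] := hs x; exists (fun ij : J => coord b ij.2 (c ij.1)).
rewrite -(pair_bigA _ (fun (i : 'I_(size s)) (j : 'I_(\dim {:A})) =>
  (coord b j (c i))%:A *: (b`_j *: s`_i))) /=.
apply: eq_bigr => i _; under eq_bigr do rewrite scalerA mulr_algl.
by rewrite -scaler_suml -coord_vbasis ?memvf.
Qed.

(** A homomorphism is determined by coordinates of the images of generators. These are merely chosen
    along a spanning family and need not depend linearly on the vector: a linear relation between
    coordinates still gives one between homomorphisms. *)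
Lemma findim_modhom X Y : findim (Mor (modcat A) X Y).
Proof.
have [s hs] := fgmod_fin_gen X; have [I [w hw]] := fgmod_kspan Y.
have [coef hcoef] := choice hw.
pose J := ('I_(size s) * I)%type; exists #|{: J}| => v.
have [c [c0 hc]] := linear_relation (fun i (ja : J) =>
  coef (modhom_fun (v i : modhom X Y) s`_ja.1) ja.2).
exists c; split=> //; apply: modhomP => x.
have [a ->] := hs x.
have lin (f : modhom X Y) : modhom_fun f (\sum_i a i *: s`_i) =
    \sum_i a i *: modhom_fun f s`_i.
  by rewrite /modhom_fun linear_sum; apply: eq_bigr => i _; rewrite linearZ.
rewrite !lin; apply: eq_bigr => j _; congr (_ *: _).
rewrite [LHS]modhom_sum.
transitivity (\sum_t (c t)%:A *: modhom_fun (v t : modhom X Y) s`_j); first by [].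
transitivity (\sum_b (\sum_t c t * coef (modhom_fun (v t : modhom X Y) s`_j) b)%:A *: w b).
  under eq_bigr do rewrite [X in _ *: X]hcoef scaler_sumr.
  rewrite exchange_big; apply: eq_bigr => b _ /=.
  rewrite scaler_suml scaler_suml; apply: eq_bigr => t _.
  by rewrite scalerA mulr_algl scalerA.
by apply: big1 => b _; rewrite (hc (j, b)) scale0r scale0r.
Qed.

Section Kernel.
Variables (X Y : fgmod A) (f : modhom X Y).

Definition kernel_pred : {pred X} := [pred x | modhom_fun f x == 0].

Fact kernel_submod_closed : submod_closed kernel_pred.
Proof.
split=> [|a x y]; first by rewrite inE /modhom_fun linear0.
by rewrite !inE modhom_linear => /eqP-> /eqP->; rewrite scaler0 addr0.
Qed.
HB.instance Definition _ :=
  GRing.isSubmodClosed.Build A X kernel_pred kernel_submod_closed.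

Record kernel_type := KernelType {
  kernel_val : X;
  kernel_valP : kernel_val \in kernel_pred }.
HB.instance Definition _ := [isSub for kernel_val].
HB.instance Definition _ := [Choice of kernel_type by <:].
HB.instance Definition _ := [SubChoice_isSubLmodule of kernel_type by <:].

(** The coordinate vectors over k whose combination lies in the kernel form a subspace; a finite
    spanning set of it gives generators. *)
Fact kernel_fin_gen : fin_gen (kernel_type : lmodType A).
Proof.
have [I [w hw]] := fgmod_kspan X.
pose n := #|I|; pose comb (u : 'rV[k]_n) := \sum_j (u 0 j)%:A *: w (enum_val j).
have combD u v : comb (u + v) = comb u + comb v.
  by rewrite -big_split; apply: eq_bigr => j _; rewrite mxE !scalerDl.
have combZ c u : comb (c *: u) = c%:A *: comb u.
  by rewrite scaler_sumr; apply: eq_bigr => j _; rewrite mxE scalerA mulr_algl scalerA.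
have comb0 : comb 0 = 0 by rewrite -[0](scale0r (0 : 'rV_n)) combZ scale0r scale0r.
have [|||B hB] := @subspace_rowspace k n (fun u => comb u \in kernel_pred).
- by rewrite comb0 rpred0.
- by move=> u v; rewrite combD; apply: rpredD.
- by move=> c u; rewrite combZ; apply: rpredZ.
have Bk r : comb (row r B) \in kernel_pred by apply/hB/row_sub.
apply: (@fin_gen_ord _ _ n (fun r => KernelType (Bk r))) => x.
have [c xE] := hw (val x).
have xc : val x = comb (\row_j c (enum_val j)).
  rewrite xE (reindex _ (onW_bij _ (enum_val_bij I))).
  by apply: eq_bigr => j _; rewrite mxE.
have /submxP[a aB] : (\row_j c (enum_val j) <= B)%MS.
  by apply/hB; rewrite -xc; apply: valP.
exists (fun r => (a 0 r)%:A); apply: val_inj; rewrite xc aB mulmx_sum_row.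
rewrite raddf_sum /= (big_morph comb combD comb0).
by apply: eq_bigr => r _; rewrite combZ.
Qed.

Definition kernel_mod : fgmod A := FGMod kernel_fin_gen.

Lemma kernel_val_linear (a : A) (x y : kernel_mod) :
  kernel_val (a *: x + y) = a *: kernel_val x + kernel_val y.
Proof. by []. Qed.

Lemma kernel_mod_is_kernel : is_kernel (mkmodhom kernel_val_linear) f.
Proof.
split=> [x y|x]; first exact: val_inj.
split=> [fx0|[y ->]]; last by apply/eqP/(kernel_valP y).
have kx : x \in kernel_pred by apply/eqP.
by exists (KernelType kx).
Qed.

End Kernel.

Section KernelProperties.
Variables (K X Y : modcat A) (i : Mor (modcat A) K X) (f : Mor (modcat A) X Y).
Hypothesis iK : is_kernel i f.

Lemma kernel_comp : i \then f = 0.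
Proof. by apply: modhomP => x; apply/iK.2; exists x. Qed.

Lemma kernel_mono V (a b : Mor (modcat A) V K) : a \then i = b \then i -> a = b.
Proof.
move=> ab; apply: modhomP => x; apply: iK.1.
exact: (congr1 (fun h : modhom V X => modhom_fun h x) ab).
Qed.

Lemma kernel_universal V (g : Mor (modcat A) V X) : g \then f = 0 ->
  exists u : Mor (modcat A) V K, u \then i = g.
Proof.
move=> gf0; have h x : exists y, modhom_fun g x = modhom_fun i y.
  by apply/iK.2; apply: (congr1 (fun h : modhom V Y => modhom_fun h x) gf0).
have [u hu] := choice h.
have u_lin (a : A) x y : u (a *: x + y) = a *: u x + u y.
  by apply: iK.1; rewrite -hu !modhom_linear !hu.
by exists (mkmodhom u_lin); apply: modhomP => x; rewrite [RHS]hu.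
Qed.

End KernelProperties.

Lemma kernel_exists (X Y : modcat A) (f : Mor (modcat A) X Y) :
  exists (K : modcat A) (i : Mor (modcat A) K X), is_kernel i f.
Proof.
by exists (kernel_mod f), (mkmodhom (kernel_val_linear (f := f))); apply: kernel_mod_is_kernel.
Qed.

(** The image of e is obtained as the kernel of 1 - e. *)
Lemma split_modcat (X : modcat A) (e : Mor (modcat A) X X) : e \then e = e ->
  exists Y (i : Mor (modcat A) Y X) (p : Mor (modcat A) X Y),
    i \then p = idmor (modcat A) Y /\ p \then i = e.
Proof.
move=> ee; have [Y [i iK]] := kernel_exists (idmor (modcat A) X - e).
have ie : i \then e = i.
  apply/eqP; rewrite eq_sym -subr_eq0; apply/eqP.
  by rewrite -[X in X - _]comp_idr -compBr; apply: (kernel_comp iK).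
have [|p pi] := kernel_universal iK (g := e).
  by rewrite compBr comp_idr ee subrr.
exists Y, i, p; split; last exact: pi.
by apply: (kernel_mono iK); rewrite -compmA pi comp_idl.
Qed.

End ModuleCategory.

Section Inclusion.
Variables (k : fieldType) (C D : lincat k) (P : D -> Prop).
Variable F : linfunctor C (full_subcat P).

Definition incl_functor : linfunctor C D :=
  @LinFunctor k C D (fun x => sval (F x)) (fun x y f => fmor F f)
    (fun x y c f g => fmor_lin F c f g) (fun x => fmor_id F x)
    (fun x y z f g => fmor_comp F f g).

End Inclusion.

Lemma functor_Rpow (k : fieldType) (C D : lincat k) (F : linfunctor C D) :
  (forall x y (f : Mor C x y), ~ invertible f -> radn 1 (fmor F f)) ->
  forall n x y (f : Mor C x y), Rpow n f -> radn n (fmor F f).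
Proof.
move=> hF; elim=> [//|n IH] x y f rf.
pose J : mor_pred C := fun x y f => radn n.+1 (fmor F f).
suff: J x y f by []; apply: rf => {x y f}.
  split=> [x y|x y f g|x y z f g|x y z f g]; rewrite /J.
  - by rewrite fmor0; apply: radn0.
  - by rewrite fmorD; apply: radnD.
  - by rewrite fmor_comp; apply: radn_compl.
  - by rewrite fmor_comp; apply: radn_compr.
move=> x y f [z [g [h [rg nh ->]]]]; rewrite /J fmor_comp -addn1.
by apply: radn_comp; [apply: IH|apply: hF].
Qed.

(** * Fibres of a functor with the covering property *)

Section CoveringFibre.
Variables (k : fieldType) (A : falgType k) (Gamma : modcat A -> Prop).
Variables (C : lincat k) (F : linfunctor C (full_subcat Gamma)).
Hypothesis hF : covering_property F.
Let D := modcat A.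
Let G : linfunctor C D := incl_functor F.

Section Fibre.
Variables (Z : D) (x0 : C) (theta : Mor D Z (G x0)).
Hypothesis theta_inv : invertible theta.

Record fibre_index := FibreIndex {
  fibre_ob : C;
  fibre_obE : F fibre_ob = F x0 }.

Lemma fibre_ob_inj : injective fibre_ob.
Proof.
move=> [z e] [z' e'] /= zz'; subst z'.
by rewrite (Prop_irrelevance e e').
Qed.

Definition fibre_cmp (t : fibre_index) : Mor D Z (G (fibre_ob t)) :=
  ecast W (Mor D Z (sval W)) (esym (fibre_obE t)) theta.

Lemma ecast_comp (Y : D) (W W' : full_subcat Gamma) (e : W = W')
    (h : Mor D (sval W) Y) (th : Mor D Z (sval W')) :
  th \then (ecast V (Mor D (sval V) Y) e h) =
  (ecast V (Mor D Z (sval V)) (esym e) th) \then h.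
Proof. by case: _ / e th. Qed.

Lemma fibre_covering : @fibre k C D G Z fibre_index fibre_ob fibre_cmp.
Proof.
have [theta' [tt' t't]] := theta_inv.
have cancel (Y : D) n (h : Mor D (G x0) Y) : radn n (theta \then h) -> radn n h.
  by move=> rh; rewrite -[h]comp_idl -t't -compmA; apply: radn_compr.
split.
  move=> y n g rg.
  have [u ru hu] := @cov_in_surj _ _ _ _ _ hF y x0 n (theta' \then g) (radn_compr _ rg).
  pose tau (i : 'I_(in_card u)) := FibreIndex (in_fib i).
  pose V t : nmodType := Mor C (fibre_ob t) y.
  pose psi0 i t : Mor C (fibre_ob t) y := single (V := V) (in_mor i : V (tau i)) t.
  exists (fun t => \sum_i psi0 i t) => [t|].
    apply: Rpow_sum => i _; rewrite /psi0.
    have [<-|tt] := pselect (tau i = t).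
      by rewrite (single_eq (V := V)); apply: ru.
    by rewrite single_neq; [apply: Rpow0|move=> e; apply: tt].
  exists [seq tau i | i <- enum 'I_(in_card u)] => s us sub.
  have -> : \sum_(t <- s) (fibre_cmp t \then fmor G (\sum_i psi0 i t)) =
      theta \then in_sum u.
    under eq_bigr do rewrite fmor_sum comp_sumr.
    rewrite big_exchange comp_sumr; apply: eq_bigr => i _.
    rewrite (big_In1 (t0 := tau i)) //.
    - rewrite /psi0 single_eq; apply/esym.
      exact: (@ecast_comp (G y) _ _ (in_fib i) (fmor F (in_mor i)) theta).
    - by apply: sub; apply: List.in_map; apply: mem_In; rewrite mem_enum.
    move=> t ti; have -> : psi0 i t = 0 by apply: (single_neq (V := V)).
    by rewrite (fmor0 G) comp0r.
  have -> : g - theta \then in_sum u = theta \then (theta' \then g - in_sum u).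
    by rewrite compBr compmA tt' comp_idl.
  exact: radn_compr.
(* The covering property gains one degree at a time, starting from coefficients already known to lie
   in R^n. *)
move=> y n psi s us; elim: n => [//|n IH] rs t ts.
have {}IH u : List.In u s -> Rpow n (psi u) by apply: IH; apply: radn_le rs.
pose ob (i : 'I_(size s)) := fibre_ob (nth t s i).
have ob_inj : injective ob.
  by move=> i j /fibre_ob_inj/(NoDup_nth us (ltn_ord i) (ltn_ord j))/val_inj.
pose u := @InFamily _ _ _ _ F y x0 _ ob ob_inj
  (fun i => fibre_obE (nth t s i)) (fun i => psi (nth t s i)).
have ru i : Rpow n (@in_mor k A Gamma C F y x0 u i) by apply: IH; apply: nth_In.
have uE : theta \then in_sum u = \sum_(t <- s) (fibre_cmp t \then fmor G (psi t)).
  rewrite comp_sumr [RHS](big_nth t) big_mkord; apply: eq_bigr => i _.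
  exact: (@ecast_comp (G y) _ _ (fibre_obE _) (fmor F (psi _)) theta).
have [i si ->] := In_nth t ts.
apply: (@cov_in_inj _ _ _ _ _ hF y x0 n u ru _ (Ordinal si)).
by apply: cancel; rewrite uE.
Qed.

End Fibre.

Lemma covering_fibre_at z : fibre_at G z.
Proof.
exists (fibre_index z), (fibre_ob (x0 := z)), (fibre_cmp (idmor D (G z))); split.
  exact/fibre_covering/invertible_id.
by exists (FibreIndex (erefl (F z))), erefl.
Qed.

Lemma covering_fibre_over Z : lies_in Gamma Z -> fibre_over G Z.
Proof.
move=> [W GW [theta theta_inv]].
have [x0 e] := cov_surj hF (exist _ W GW).
have eW : sval (F x0) = W by rewrite e.
subst W; exists (fibre_index x0), (fibre_ob (x0 := x0)), (fibre_cmp (x0 := x0) theta).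
exact: fibre_covering.
Qed.

End CoveringFibre.

(** * Modules in an Auslander-Reiten component *)

Section Component.
Variables (k : fieldType) (A : falgType k) (ind Gamma : modcat A -> Prop).
Hypotheses (hind : is_indA ind) (hGamma : is_AR_component ind Gamma).

Lemma component_ind W : Gamma W -> ind W.
Proof.
case: hGamma => X indX hX /hX XW.
suff [h _] : ind X <-> ind W by apply: h.
elim: XW => {W hX indX X} [X Y [? ? _]|X|X Y _ [? ?]|X Y Z _ [? ?] _ [? ?]] //.
by split; auto.
Qed.

Lemma component_indecomposable W : Gamma W -> indecomposable W.
Proof. by move=> /component_ind; apply: hind.1. Qed.

Lemma isomorphic_lies_in (U V : modcat A) :
  isomorphic U V -> lies_in Gamma V -> lies_in Gamma U.
Proof. by move=> UV [W GW VW]; exists W => //; apply: isomorphic_trans VW. Qed.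

(** Conjugating g by isomorphisms to the chosen representatives preserves its layer and yields an
    arrow of the quiver. *)
Lemma arrow_lies_in (U V : modcat A) (g : Mor (modcat A) U V) :
  indecomposable U -> in_layer 1 g -> lies_in Gamma V -> lies_in Gamma U.
Proof.
move=> hU [rg nrg] [W GW [v [v' [vv' v'v]]]].
have [U0 [[indU0 [u [u' [uu' u'u]]]] _]] := hind.2 U hU.
exists U0; last by exists u, u'.
case: hGamma => X indX hX; apply/hX.
apply: (Relation_Operators.rst_trans _ _ _ W); first exact/hX.
apply/Relation_Operators.rst_sym/Relation_Operators.rst_step.
split=> //; first exact: component_ind.
exists (u' \then g \then v); split; first exact/radn_compl/radn_compr.
move=> h; apply: nrg; suff -> : g = u \then (u' \then g \then v) \then v'.
  exact/radn_compl/radn_compr.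
by rewrite !compmA uu' comp_idl -compmA vv' comp_idr.
Qed.

End Component.

Theorem theorem1 (k : fieldType) (A : falgType k) (hk : perfect_field k)
  (ind Gamma : modcat A -> Prop)
  (hind : is_indA ind) (hGamma : is_AR_component ind Gamma)
  (C : lincat k) (hC : category_with_length C)
  (F : linfunctor C (full_subcat Gamma)) (hF : covering_property F)
  (X Y : modcat A) (f : Mor (modcat A) X Y)
  (hXY : forall (W : modcat A),
     dsum W (fun b : bool => if b then X else Y) ->
     forall U : bool -> modcat A, dsum W U ->
     indecomposable (U true) -> lies_in Gamma (U true))
  (d : nat) (hd : (1 <= d)%N)
  (hf : in_layer d f) (hfF : homogeneous_upto F d.+1 f)
  (n : nat) (hn : has_left_degree d f n) :
  exists f' : Mor (modcat A) X Y, radn d.+1 (f - f') /\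
  exists (K : modcat A) (i : Mor (modcat A) K X),
    is_kernel i f' /\ in_layer n i /\
  (* K^(m) is K_ (Some m), taken to be zero for m < n; K^(oo) is K_ None *)
  exists (K_ : option nat -> modcat A) (D : dsum K K_),
    [/\ forall m, (m < n)%N -> is_zero (K_ (Some m)),
        forall m, (n <= m)%N ->
          forall (U : bool -> modcat A) (E : dsum (K_ (Some m)) U),
          indecomposable (U true) ->
          in_layer m (dinj E true \then dinj D (Some m) \then i),
        forall (U : bool -> modcat A) (E : dsum (K_ None) U),
          indecomposable (U true) ->
          rad_inf (dinj E true \then dinj D None \then i)
      & forall (l : nat) (Z : modcat A), (n <= l)%N -> indecomposable Z ->
          exact_layers d n l Z
            (fun m => dinj D (Some m) \then i) f].
Proof.
have [h [r [[p [q [x [y [DX [DY [phi hphi]]]]]]] rr fhr]]] := hfF.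
have [rf nrf] := hf.
pose G := incl_functor F.
have G_rad m u v (g : Mor C u v) : Rpow m g -> radn m (fmor G g).
  by apply: functor_Rpow => {m u v g} u v g; apply: (cov_rad hF).
have G_fibre z : fibre_at G z by apply: covering_fibre_at.
have findimA (U V : modcat A) : findim (Mor (modcat A) U V) by apply: findim_modhom.
have splitA := @split_modcat k A.
have G_lies z : lies_in Gamma (G z).
  by exists (G z); [apply: (svalP (F z))|apply: isomorphic_refl].
have G_indec z : indecomposable (G z).
  exact: component_indecomposable hind hGamma _ (svalP (F z)).
have D_fibre Z : indecomposable Z -> fibre_over G Z \/
    forall m z (g : Mor (modcat A) Z (G z)), radn m g -> radn m.+1 g.
  move=> hZ; have [LZ|nLZ] := pselect (lies_in Gamma Z).
    by left; apply: covering_fibre_over.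
  right=> m z g rg.
  (* Lying in the component is inherited by sources of irreducible morphisms, so [radn_outside]
     applies to Z. *)
  have Piso (u v : modcat A) : isomorphic u v -> lies_in Gamma v -> lies_in Gamma u.
    exact: isomorphic_lies_in.
  have Parr (u v : modcat A) (a : Mor (modcat A) u v) : indecomposable u ->
      indecomposable v -> in_layer 1 a -> lies_in Gamma v -> lies_in Gamma u.
    by move=> hu _; apply: (arrow_lies_in hind hGamma).
  exact: (radn_outside findimA Piso Parr hZ (G_indec z) nLZ (G_lies z) rg).
(* Since h lies in rad^d and F reflects powers, the entries of phi lie in R^d; cutting them down to
   degree d changes h only by a morphism of rad^(d+1). *)
pose phi' s t := graded_part d (phi s t).
pose f' : Mor (modcat A) X Y :=
  \sum_s (dprj DX s \then \sum_t (fmor G (phi' s t) \then dinj DY t)).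
have f'E s t : dinj DX s \then f' \then dprj DY t = fmor G (phi' s t).
  rewrite (dsum_sum_inj DX (fun s => \sum_t (fmor G (phi' s t) \then dinj DY t))).
  exact: (dsum_sum_prj DY (fun t => fmor G (phi' s t))).
have rh : radn d h.
  have -> : h = f - r by rewrite fhr addrK.
  by apply: radnB => //; apply: radn_le rr.
have ff' : radn d.+1 (f - f').
  rewrite fhr addrAC; apply: radnD => //.
  apply: (dsum_radn (d := DY)) => t; apply: (dsum_radnr (d := DX)) => s.
  have -> : dinj DX s \then ((h - f') \then dprj DY t) = fmor G (phi s t - phi' s t).
    by rewrite compBl compBr !compmA f'E (fmorB G) hphi.
  apply: G_rad; apply: (graded_partB hC).
  apply: (fmor_Rpow G_fibre); rewrite -[fmor G _]/(fmor F (phi s t)) -hphi.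
  exact/radn_compl/radn_compr.
exists f'; split=> //.
have [K [i iK]] := kernel_exists f'; exists K, i; split=> //.
have phi'_hom s t : homdeg d (phi' s t) by apply: graded_part_homdeg.
have i_mono := kernel_mono iK.
have i_f' := kernel_comp iK.
have i_univ := @kernel_universal _ _ _ _ _ _ _ iK.
have [I [E Emax]] := @maximal_family _ _ _ G findimA G_indec _ _ _ _ _ _ DX phi' i.
have gen := maximal_family_generates hC findimA G_indec G_rad G_fibre D_fibre
  (DY := DY) phi'_hom f'E i_f' i_univ E Emax.
exact: (kernel_layers hC findimA splitA G_indec G_rad G_fibre D_fibre phi'_hom f'E
  i_mono i_f' rf ff' gen hn).
Qed.
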